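(* Let $\sigma$ be a generic circuit signature of an oriented matroid $M$. The following are equivalent: (1) $\sigma$ is the circuit signature induced by some single-element lifting of $M$. (2) For every generic cocircuit signature $\sigma^*$ of $M$ induced by a generic single-element extension of $M$, the map $\beta_{\sigma,\sigma^*}$ is a bijection between the bases of $M$ and the $(\sigma,\sigma^* )$-compatible orientations of $M$. (3) For every generic lexicographic cocircuit signature $\sigma^*$ of $M$, the map $\beta_{\sigma,\sigma^*}$ maps bases of $M$ to $\sigma$-compatible orientations of $M$.
   Context: Oriented matroids are finite; $E$ is the ground set of $M$ and $r$ its rank. For a signed set $X$, $\underline X$ denotes its support. ''Circuit'' and ''cocircuit'' without the word ''signed'' refer to the underlying matroid. For a basis $B$: if $e\notin B$, $C(B,e)$ is the fundamental circuit (the unique circuit contained in $B\cup e$); if $e\in B$, $C^*(B,e)$ is the fundamental cocircuit (the unique cocircuit disjoint from $B\setminus e$). A single-element extension of $M$ is an oriented matroid $M'$ of rank $r$ on $E\sqcup\{f\}$ with $M=M'\setminus f$; it is generic if every circuit of $M'$ containing $f$ is spanning. A single-element lifting of $M$ is an oriented matroid $\widetilde M$ of rank $r+1$ on $E\sqcup\{g\}$ with $M=\widetilde M/g$. A cocircuit signature of $M$ is a map $\sigma^*$ from the signed cocircuits of $M$ to $\{+,-,0\}$ with $\sigma^*(-D)=-\sigma^*(D)$; it is generic if it never takes the value $0$. Circuit signatures $\sigma$ are defined analogously on signed circuits. An extension $M'$ induces the cocircuit signature $\sigma^*(D):=D'(f)$, where $D'$ is the unique signed cocircuit of $M'$ with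 $D'|_E=D$. A lifting $\widetilde M$ induces the circuit signature $\sigma(C):=\widetilde C(g)$, where $\widetilde C$ is the unique signed circuit of $\widetilde M$ with $\widetilde C|_E=C$. For a generic signature and an unsigned circuit $\underline C$ (resp. cocircuit $\underline D$), $\sigma(\underline C)$ (resp. $\sigma^*(\underline D)$) denotes the one of the two signed circuits (resp. cocircuits) with that support on which the signature is $+$. Lexicographic cocircuit signature: given an ordered subset $E'=(e_1,\dots,e_k)$ of $E$ and signs $s_1,\dots,s_k\in\{+,-\}$, set $\sigma^*(D)=0$ if $\underline D\cap E'=\emptyset$, and otherwise $\sigma^*(D)=s_i\cdot D(e_i)$ where $i$ is the first index with $e_i\in\underline D$. It is generic if and only if $E'$ is spanning. An orientation of $M$ is a map $\mathcal O:E\to\{+,-\}$. It is conformal with a signed circuit or cocircuit $C$ if $\mathcal O(e)=C(e)$ for all $e\in\underline C$. It is $\sigma$-compatible (resp. $\sigma^*$-compatible) if $\sigma$ (resp. $\sigma^*$) is $+$ on every signed circuit (resp. cocircuit) conformal with $\mathcal O$, and $(\sigma,\sigma^* )$-compatible if both hold. For a generic circuit signature $\sigma$ and a generic cocircuit signature $\sigma^*$, the map $\beta_{\sigma,\sigma^*}$ sends a basis $B$ of $M$ to the orientation in which each $e\notin B$ gets its sign in $\sigma(C(B,e))$ and each $e\in B$ gets its sign in $\sigma^*(C^*(B,e))$. *)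

(* Defs.v *)
From mathcomp Require Import all_boot.

Set Implicit Arguments.
Unset Strict Implicit.
Unset Printing Implicit Defensive.

(* {+, -} is [bool] with [true] for +, and {+, -, 0} is [option bool] with
   [None] for 0. *)
Notation sign := (option bool).
Notation plus := (Some true).
Notation minus := (Some false).
Notation zero := (@None bool).

Definition sopp (s : sign) : sign := omap negb s.

Definition smul (b : bool) (s : sign) : sign := if b then s else sopp s.

Notation signed_set E := {ffun E -> sign}.

Section SignedSets.
Variable E : finType.
Implicit Types X Y : signed_set E.

Definition supp X : {set E} := [set e | X e != zero].
Definition pos_part X : {set E} := [set e | X e == plus].
Definition neg_part X : {set E} := [set e | X e == minus].

Definition signed0 : signed_set E := [ffun => zero].
Definition signed_opp X : signed_set E := [ffun e => sopp (X e)].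

Definition orthogonal X Y : bool :=
  [disjoint supp X & supp Y] ||
  ([exists e in supp X, X e == Y e] &&
   [exists e in supp X, X e == sopp (Y e)]).

End SignedSets.

(* The circuit axioms; the last one is weak elimination. *)
Record oriented_matroid (E : finType) := OrientedMatroid {
  circuits : {set signed_set E};
  circuits_neq0 : signed0 E \notin circuits;
  circuits_opp : forall X, X \in circuits -> signed_opp X \in circuits;
  circuits_incomparable : forall X Y, X \in circuits -> Y \in circuits ->
    supp X \subset supp Y -> X = Y \/ X = signed_opp Y;
  circuits_elim : forall X Y e, X \in circuits -> Y \in circuits ->
    X <> signed_opp Y -> e \in pos_part X :&: neg_part Y ->
    exists Z, [/\ Z \in circuits,
      pos_part Z \subset (pos_part X :|: pos_part Y) :\ e &
      neg_part Z \subset (neg_part X :|: neg_part Y) :\ e]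
}.

Section UnderlyingMatroid.
Variables (E : finType) (M : oriented_matroid E).
Implicit Types A B C D : {set E}.

Definition ucircuits : {set {set E}} := [set supp X | X in circuits M].

Definition indep A : bool := [forall C in ucircuits, ~~ (C \subset A)].

Definition bases : {set {set E}} := [set B | maxset indep B].

Definition rank : nat := \max_(A : {set E} | indep A) #|A|.

Definition spanning A : bool := [exists B in bases, B \subset A].

(* The circuits of the dual matroid: a set is dependent in the dual iff it lies
   in no complement of a basis, that is, iff it meets every basis. *)
Definition ucocircuits : {set {set E}} :=
  [set D | minset (fun A => [forall B in bases, A :&: B != set0]) D].

(* The signed circuits of the dual oriented matroid, i.e., the unique signature
   of the cocircuits that is orthogonal to the signed circuits. *)
Definition cocircuits : {set signed_set E} :=
  [set D | (supp D \in ucocircuits)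
           && [forall X in circuits M, orthogonal X D]].

(* For a basis B, the picked set exists and is unique when e \notin B (resp.
   e \in B); the default set0 is never used then. *)
Definition fund_circuit B (e : E) : {set E} :=
  odflt set0 [pick C in ucircuits | C \subset e |: B].

Definition fund_cocircuit B (e : E) : {set E} :=
  odflt set0 [pick D in ucocircuits | [disjoint D & B :\ e]].

End UnderlyingMatroid.

(* The ground set of a one-element extension or lifting of an oriented matroid
   on E is [option E], the new element being [None]. *)
Section OneElement.
Variable E : finType.
Implicit Types (M : oriented_matroid E) (N : oriented_matroid (option E)).

Definition restrict (X : signed_set (option E)) : signed_set E :=
  [ffun e => X (Some e)].

Definition deletion_circuits N : {set signed_set E} :=
  [set restrict X | X in circuits N & X None == zero].

Definition contraction_circuits N : {set signed_set E} :=
  let V := [set restrict X | X in circuits N] :\ signed0 E in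
  [set X in V | [forall Y in V, ~~ (supp Y \proper supp X)]].

Definition is_extension M N : Prop :=
  rank N = rank M /\ deletion_circuits N = circuits M.

Definition is_generic_extension M N : Prop :=
  is_extension M N /\
  {in ucircuits N, forall C : {set option E}, None \in C -> spanning N C}.

Definition is_lifting M N : Prop :=
  rank N = (rank M).+1 /\ contraction_circuits N = circuits M.

(* When N is an extension of M and D a signed cocircuit of M, there is a unique
   signed cocircuit of N that restricts to D; dually for liftings. *)
Definition extension_signature N (D : signed_set E) : sign :=
  if [pick D' in cocircuits N | restrict D' == D] is Some D' then D' None
  else zero.

Definition lifting_signature N (X : signed_set E) : sign :=
  if [pick X' in circuits N | restrict X' == X] is Some X' then X' None
  else zero.

End OneElement.

(* A (co)circuit signature is a function on all signed sets, of which only the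
   values on the signed (co)circuits matter. *)
Section Signatures.
Variables (E : finType) (M : oriented_matroid E).
Implicit Types sigma sigmas : signed_set E -> sign.

Definition signature_on (S : {set signed_set E}) sigma : Prop :=
  {in S, forall X, sigma (signed_opp X) = sopp (sigma X)}.

Definition generic_on (S : {set signed_set E}) sigma : Prop :=
  {in S, forall X, sigma X <> zero}.

Definition generic_circuit_signature sigma : Prop :=
  signature_on (circuits M) sigma /\ generic_on (circuits M) sigma.

Definition generic_cocircuit_signature sigmas : Prop :=
  signature_on (cocircuits M) sigmas /\ generic_on (cocircuits M) sigmas.

Definition induced_by_lifting sigma (N : oriented_matroid (option E)) : Prop :=
  {in circuits M, sigma =1 lifting_signature N}.

Definition induced_by_extension sigmas (N : oriented_matroid (option E)) :
    Prop :=
  {in cocircuits M, sigmas =1 extension_signature N}.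

Fixpoint lex_sign (s : seq (E * bool)) (D : signed_set E) : sign :=
  if s is (e, b) :: s' then
    if e \in supp D then smul b (D e) else lex_sign s' D
  else zero.

Definition lexicographic sigmas : Prop :=
  exists s : seq (E * bool),
    uniq (unzip1 s) /\ {in cocircuits M, sigmas =1 lex_sign s}.

(* The one of the two elements of S with support C on which sigma is +. *)
Definition positive_signing (S : {set signed_set E}) sigma (C : {set E}) :
    signed_set E :=
  odflt (signed0 E) [pick X in S | (supp X == C) && (sigma X == plus)].

Definition orientation := {ffun E -> bool}.

Definition conformal (O : orientation) (X : signed_set E) : bool :=
  [forall e in supp X, Some (O e) == X e].

Definition circuit_compatible sigma (O : orientation) : bool :=
  [forall X in circuits M, conformal O X ==> (sigma X == plus)].

Definition cocircuit_compatible sigmas (O : orientation) : bool :=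
  [forall D in cocircuits M, conformal O D ==> (sigmas D == plus)].

Definition compatible sigma sigmas (O : orientation) : bool :=
  circuit_compatible sigma O && cocircuit_compatible sigmas O.

(* For a basis B the sign read off at e is never zero, hence is + or -
   according to the test. *)
Definition beta sigma sigmas (B : {set E}) : orientation :=
  [ffun e =>
    (if e \in B
     then positive_signing (cocircuits M) sigmas (fund_cocircuit M B e) e
     else positive_signing (circuits M) sigma (fund_circuit M B e) e) == plus].

End Signatures.

(* Main.v *)
Require Import Defs.
From mathcomp Require Import all_boot.

(* For a basis B let D_B be the signed set on E + g that is - at g and equals
   beta(B) outside B, and let C_B be the one on E + f that is + at f and equals
   - beta(B) on B.  A generic sigma comes from a lifting iff every D_B is
   orthogonal to every circuit X extended by sigma(X) at g; dually, sigma* comes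
   from an extension iff every C_B is orthogonal to every extended cocircuit.
   This is [consistent].  In an extension or lifting these sets are fundamental
   (co)circuits, which gives necessity.  Conversely the C_B together with the
   circuits of M satisfy weak elimination.  The lexicographic signatures are
   consistent, and those ordered along a basis B can prescribe beta(B) on B
   arbitrarily, so (3) says exactly that sigma is consistent.

   Consistency makes beta(B) compatible and, by painting, beta injective.  For
   surjectivity, process the elements one at a time, replacing the two
   orientations of e by its contraction and its deletion: orthogonality shows
   that the number of compatible states does not decrease, and once all elements
   are processed the compatible states are the bases. *)

Set Implicit Arguments.
Unset Strict Implicit.
Unset Printing Implicit Defensive.

(** Only the circuit axioms are given, while every later argument plays circuits off against
    cocircuits. The first obstacle is therefore to show that each cocircuit of the underlying
    matroid can be signed orthogonally to all circuits. Circuits and cocircuits then form a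
    symmetric [signed_pair], and conversely every such pair is an oriented matroid, so the dual
    exists. Liftings get no construction of their own: they are duals of extensions of the dual, in
    which sigma becomes a cocircuit signature and the bases become the complements [~: B]; hence the
    two instances of [consistent]. In building an extension, the extended cocircuits are known to be
    orthogonal to the candidate circuits, but they are only those cocircuits of the extension that
    contain the new element. Painting is thus available only with that element as root, and the hard
    case of elimination is that of two new circuits with opposite signs there. *)

Lemma soppK : involutive sopp.
Proof. by case=> [[]|]. Qed.

Lemma sopp_eq0 s : (sopp s == zero) = (s == zero).
Proof. by case: s => [[]|]. Qed.

Lemma sopp_neq s t : s != zero -> t != zero -> s <> t -> s = sopp t.
Proof. by case: s t => [[]|] [[]|]. Qed.

(** * Orthogonality of signed sets *)

Section SignedSetTheory.
Variable E : finType.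
Implicit Types X Y : signed_set E.

Lemma signed_oppE X e : signed_opp X e = sopp (X e).
Proof. by rewrite ffunE. Qed.

Lemma signed_oppK : involutive (@signed_opp E).
Proof. by move=> X; apply/ffunP=> e; rewrite !ffunE soppK. Qed.

Lemma supp_opp X : supp (signed_opp X) = supp X.
Proof. by apply/setP=> e; rewrite !inE signed_oppE sopp_eq0. Qed.

Lemma suppE X e : (e \in supp X) = (X e != zero).
Proof. by rewrite inE. Qed.

Lemma notin_supp X e : e \notin supp X -> X e = zero.
Proof. by rewrite inE negbK => /eqP. Qed.

Lemma supp_eq0 X : supp X = set0 -> X = signed0 E.
Proof.
by move=> X0; apply/ffunP=> e; rewrite ffunE; apply: notin_supp; rewrite X0 inE.
Qed.

Lemma sign_at X e : e \in supp X -> exists b, X e = Some b.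
Proof. by rewrite inE; case: (X e) => // b _; exists b. Qed.

Lemma orthogonalP X Y :
  reflect ((exists2 e, X e != zero & X e = Y e) <->
           (exists2 e, X e != zero & X e = sopp (Y e)))
          (orthogonal X Y).
Proof.
apply: (iffP orP) =>
  [[dXY|/andP[/existsP[e /andP[]] + /eqP + /existsP[e' /andP[]] + /eqP]]|XY].
- suff no e : X e != zero -> Y e = zero.
    by split=> -[e X0 Xe]; move: (X0); rewrite Xe (no e X0).
  move=> X0; apply: notin_supp; move/disjointFr: dXY => -> //.
  by rewrite inE.
- by rewrite !inE => *; split=> _; [exists e'|exists e].
case: (boolP [disjoint supp X & supp Y]) => [|/pred0Pn[e]]; first by left.
rewrite /= !inE => /andP[X0 Y0]; right.
have [Xe|Xe] := eqVneq (X e) (Y e).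
  have /XY[e' X0' Xe'] : exists2 e, X e != zero & X e = Y e by exists e.
  by apply/andP; split; apply/existsP; [exists e|exists e'];
    rewrite inE ?X0 ?Xe ?X0' ?Xe' eqxx // andbT -Xe.
have Xe' := sopp_neq X0 Y0 (elimN eqP Xe).
have /XY[e' X0' Xe1] : exists2 e, X e != zero & X e = sopp (Y e) by exists e.
by apply/andP; split; apply/existsP; [exists e'|exists e];
  rewrite inE ?X0 ?X0' /= ?Xe' ?Xe1.
Qed.

Lemma orthogonalC X Y : orthogonal X Y = orthogonal Y X.
Proof.
suff imp X' Y' : orthogonal X' Y' -> orthogonal Y' X' by apply/idP/idP;
  apply: imp.
move=> /orthogonalP XY; apply/orthogonalP.
split=> -[e Y0 Ye].
  have /XY[e' X0' Xe'] : exists2 e, X' e != zero & X' e = Y' e.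
    by exists e; rewrite -?Ye.
  by exists e'; [rewrite -sopp_eq0 -Xe'|rewrite Xe' soppK].
have /XY[e' X0' Xe'] : exists2 e, X' e != zero & X' e = sopp (Y' e).
  by exists e; [rewrite -sopp_eq0 -Ye|rewrite Ye soppK].
by exists e'; rewrite -?Xe'.
Qed.

Lemma orthogonal_oppr X Y : orthogonal X (signed_opp Y) = orthogonal X Y.
Proof.
suff imp X' Y' : orthogonal X' Y' -> orthogonal X' (signed_opp Y').
  by apply/idP/idP; [rewrite -{2}(signed_oppK Y)|]; apply: imp.
move=> /orthogonalP[XY YX]; apply/orthogonalP.
split=> -[e X0]; rewrite ?signed_oppE ?soppK => Xe.
  by have [|e' ? ?] := YX; [exists e|exists e'; rewrite ?signed_oppE ?soppK].
by have [|e' ? ?] := XY; [exists e|exists e'; rewrite ?signed_oppE].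
Qed.

Lemma orthogonal_disagree X Y e : orthogonal X Y -> X e != zero -> X e = Y e ->
  exists2 x, X x != zero & X x = sopp (Y x).
Proof. by move=> /orthogonalP[XY _] X0 Xe; apply: XY; exists e. Qed.

Lemma orthogonal_agree X Y e :
  orthogonal X Y -> X e != zero -> X e = sopp (Y e) ->
  exists2 x, X x != zero & X x = Y x.
Proof. by move=> /orthogonalP[_ XY] X0 Xe; apply: XY; exists e. Qed.

Lemma orthogonal_intro X Y :
  (forall e, X e != zero -> X e = Y e ->
    exists2 x, X x != zero & X x = sopp (Y x)) ->
  (forall e, X e != zero -> X e = sopp (Y e) ->
    exists2 x, X x != zero & X x = Y x) ->
  orthogonal X Y.
Proof. by move=> h1 h2; apply/orthogonalP; split=> -[e];
  [apply: h1|apply: h2]. Qed.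

End SignedSetTheory.

(* Minty's self-dual description of a matroid by its circuits and cocircuits. *)
Record dual_pair (E : finType) (U V : {set {set E}}) : Prop := DualPair {
  pair_neq0l : set0 \notin U;
  pair_neq0r : set0 \notin V;
  pair_antil : forall C C', C \in U -> C' \in U -> C \subset C' -> C = C';
  pair_antir : forall D D', D \in V -> D' \in V -> D \subset D' -> D = D';
  pair_meet : forall C D e, C \in U -> D \in V -> e \in C -> e \in D ->
    exists2 x, x != e & (x \in C) && (x \in D);
  pair_paint : forall e (K : {set E}),
    (exists2 C, C \in U & (e \in C) && (C \subset e |: K)) \/
    (exists2 D, D \in V & (e \in D) && [disjoint D & K :\ e])
}.

(** * Bases of a matroid given by circuits and cocircuits *)

Section DualPairTheory.
Variables (E : finType) (U V : {set {set E}}).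
Implicit Types B C D K I S : {set E}.

(** Independent and spanning, in a form in which complementation exchanges the two conditions; this
    makes facts on bases dualise through [basis_of_pairC]. *)
Definition basis_of_pair B :=
  [forall C in U, ~~ (C \subset B)] && [forall D in V, ~~ [disjoint D & B]].

Lemma basis_of_pairP B :
  reflect ((forall C, C \in U -> ~~ (C \subset B)) /\
           (forall D, D \in V -> exists2 x, x \in D & x \in B))
          (basis_of_pair B).
Proof.
apply: (iffP andP) => -[h1 h2]; split.
- by move=> C UC; have /forallP/(_ C)/implyP/(_ UC) := h1.
- move=> D VD; have /forallP/(_ D)/implyP/(_ VD) := h2.
  by move=> /pred0Pn[x /andP[]] /=; exists x.
- by apply/forallP=> C; apply/implyP; apply: h1.
apply/forallP=> D; apply/implyP=> /h2[x xD xB]; apply/pred0Pn; exists x.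
by rewrite /= xD xB.
Qed.

End DualPairTheory.

Lemma dual_pairC (E : finType) (U V : {set {set E}}) :
  dual_pair U V -> dual_pair V U.
Proof.
case=> h1 h2 h3 h4 h5 h6; split=> // [C D e VC UD eC eD|e K].
  by have [x xe] := h5 _ _ _ UD VC eD eC; rewrite andbC => xCD; exists x.
(* Avoiding [K :\ e] is the same as lying in [e |: ~: K], so complementing the colour class swaps
   the two alternatives. *)
have [[C UC /andP[eC sC]]|[D VD /andP[eD dD]]] := h6 e (~: K); [right|left].
  exists C => //; rewrite eC disjoints_subset; apply/subsetP=> x /(subsetP sC).
  by rewrite !inE negb_and negbK.
exists D => //; rewrite eD; apply/subsetP=> x xD.
by move: (disjointFr dD xD); rewrite !inE; case: (x == e); case: (x \in K).
Qed.

Lemma basis_of_pairC (E : finType) (U V : {set {set E}}) (B : {set E}) :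
  basis_of_pair V U (~: B) = basis_of_pair U V B.
Proof.
rewrite /basis_of_pair andbC; congr (_ && _); apply: eq_forallb => C.
  by rewrite disjoints_subset setCK.
by rewrite disjoints_subset.
Qed.

Section DualPairTheory2.
Variables (E : finType) (U V : {set {set E}}).
Hypothesis UV : dual_pair U V.
Implicit Types B C D K I S : {set E}.

Lemma basis_circuit B e : basis_of_pair U V B -> e \notin B ->
  exists2 C, C \in U & (e \in C) && (C \subset e |: B).
Proof.
move=> /basis_of_pairP[_ hV] eB; have [//|[D VD /andP[eD dD]]] :=
  pair_paint UV e B.
have [x xD xB] := hV _ VD; move: (disjointFr dD xD).
by rewrite !inE xB andbT => /negbFE/eqP xe; rewrite -xe xB in eB.
Qed.

Lemma basis_circuit_trace B C e : basis_of_pair U V B -> C \in U ->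
  C \subset e |: B -> e \notin B -> C :\: B = [set e].
Proof.
move=> /basis_of_pairP[hU _] UC sC eB; apply/setP=> x; rewrite !inE.
apply/andP/eqP=> [[xB /(subsetP sC)]|->].
  by rewrite !inE (negPf xB) orbF => /eqP.
split=> //; apply: contraT => eC; case/negP: (hU _ UC).
apply/subsetP=> y yC; have := subsetP sC _ yC; rewrite !inE.
by case: eqP yC eC => // -> ->.
Qed.

(** Take a maximal circuit-free B between I and S. If a cocircuit D meets S in [x] outside B, then
    [x |: B] contains a circuit through [x], which meets D a second time, and that element lies in
    B. *)
Lemma basis_extend I S : (forall C, C \in U -> ~~ (C \subset I)) ->
  (forall D, D \in V -> exists2 x, x \in D & x \in S) -> I \subset S ->
  exists B, [/\ basis_of_pair U V B, I \subset B & B \subset S].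
Proof.
move=> hI hS sIS.
pose p (A : {set E}) := [forall C in U, ~~ (C \subset A)] && (A \subset S).
have pI : p I.
  by rewrite /p sIS andbT; apply/forallP=> C; apply/implyP=> /hI.
have [B /maxsetP[/andP[/forallP hB sBS] maxB] sIB] := maxset_exists pI.
exists B; split=> //; apply/basis_of_pairP; split=> [C UC|D VD].
  exact: implyP (hB C) UC.
have [x xD xS] := hS D VD.
have [xB|xB] := boolP (x \in B); first by exists x.
have : ~~ p (x |: B).
  apply/negP=> /maxB/(_ (subsetUr _ _)) eqB.
  by move: xB; rewrite -eqB !inE eqxx.
rewrite /p subUset sub1set xS sBS !andbT negb_forall => /existsP[C].
rewrite negb_imply negbK => /andP[UC sC].
have xC : x \in C.
  apply: contraT => xC; case/negP: (implyP (hB C) UC).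
  apply/subsetP=> y yC; have := subsetP sC _ yC; rewrite !inE.
  by case: eqP yC xC => // -> ->.
have [y yx /andP[yC yD]] := pair_meet UV UC VD xC xD.
by exists y => //; have := subsetP sC _ yC; rewrite !inE (negPf yx).
Qed.

(** The fundamental cocircuit D of [e] meets B' in some [f]. A circuit inside [f |: (B :\ e)] would
    meet D in [f] alone. A cocircuit meeting B in [e] alone meets the fundamental circuit of [f],
    which contains [e], in a second element, and that one lies in the new basis. *)
Lemma basis_exchange B B' e : basis_of_pair U V B -> basis_of_pair U V B' ->
  e \in B -> e \notin B' ->
  exists f, [/\ f \in B', f \notin B & basis_of_pair U V (f |: (B :\ e))].
Proof.
move=> bB bB' eB eB'.
have bBC : basis_of_pair V U (~: B) by rewrite basis_of_pairC.
have /basis_of_pairP[hU hV] := bB.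
have [D VD /andP[eD sD]] : exists2 C, C \in V & (e \in C) && (C \subset e |: ~: B).
  have [[C UC /andP[eC sC]]|[D VD /andP[eD dD]]] := pair_paint UV e (B :\ e).
    case/negP: (hU _ UC); apply: subset_trans sC _.
    by rewrite setD1K.
  exists D => //; rewrite eD; apply/subsetP=> x xD; move: (disjointFr dD xD).
  by rewrite !inE; case: (x == e) => //= ->.
have [_ /(_ _ VD)[f fD fB']] := basis_of_pairP _ _ _ bB'.
have fe : f != e by apply: contraNneq eB' => <-.
have fB : f \notin B by have := subsetP sD _ fD; rewrite !inE (negPf fe).
exists f; split=> //; apply/basis_of_pairP; split=> [C UC|D' VD'].
  apply/negP=> sC; have fC : f \in C.
    apply: contraT => fC; case/negP: (hU _ UC); apply/subsetP=> x xC.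
    have := subsetP sC _ xC; rewrite !inE.
    by case: eqP xC fC => [-> ->|_ _ _ /andP[]].
  have [x xf /andP[xC xD]] := pair_meet UV UC VD fC fD.
  have := subsetP sD _ xD; have := subsetP sC _ xC; rewrite !inE (negPf xf) /=.
  by move=> /andP[/negPf-> ->].
have [C UC /andP[fC sC]] := basis_circuit bB fB.
have eC : e \in C.
  have [x xf /andP[xC xD]] := pair_meet UV UC VD fC fD.
  have := subsetP sD _ xD; have := subsetP sC _ xC; rewrite !inE (negPf xf) /=.
  by move=> ->; rewrite orbF => /eqP <-.
have [x xD' xB] := hV _ VD'.
have [xe|xe] := eqVneq x e; last by exists x; rewrite // !inE xe xB orbT.
have eD' : e \in D' by rewrite -xe.
have [y ye /andP[yC yD']] := pair_meet UV UC VD' eC eD'.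
exists y => //; have := subsetP sC _ yC; rewrite !inE ye /=; case: eqP => //=.
Qed.

Lemma basis_subset B B' : basis_of_pair U V B -> basis_of_pair U V B' ->
  B \subset B' -> B = B'.
Proof.
move=> bB bB' sBB'; apply/eqP; rewrite eqEsubset sBB'; apply/subsetP=> x xB'.
apply: contraT => xB; have [C UC /andP[xC sC]] := basis_circuit bB xB.
have /basis_of_pairP[hU _] := bB'; case/negP: (hU _ UC).
by apply: subset_trans sC _; rewrite subUset sub1set xB'.
Qed.

(* Induction along a chain of exchanges leading from any basis to B'. *)
Lemma basis_connected (P : {set E} -> Prop) B' : P B' -> basis_of_pair U V B' ->
  (forall B e f, basis_of_pair U V B -> basis_of_pair U V (f |: (B :\ e)) ->
    e \in B -> e \notin B' -> f \in B' -> f \notin B ->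
    P (f |: (B :\ e)) -> P B) ->
  forall B, basis_of_pair U V B -> P B.
Proof.
move=> PB' bB' step B; have [n] := ubnP #|B :\: B'|.
elim: n B => // n IHn B ltn bB.
have [|] := boolP (B \subset B'); first by move=> /(basis_subset bB bB') ->.
move=> /subsetPn[e eB eB'].
have [f [fB' fB bf]] := basis_exchange bB bB' eB eB'.
apply: (step _ _ _ bB bf) => //; apply: IHn => //; rewrite -ltnS.
apply: leq_trans ltn; rewrite ltnS; apply: proper_card; apply/properP; split.
  apply/subsetP=> x; rewrite !inE; case: eqP => [->|_] /=.
    by rewrite fB'.
  by move=> /andP[-> /andP[_ ->]].
by exists e; rewrite !inE ?eB' ?eB // eqxx /= orbF; case: eqP fB' eB' => // ->
  ->.
Qed.

Lemma basis_card B B' : basis_of_pair U V B -> basis_of_pair U V B' ->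
  #|B| = #|B'|.
Proof.
move=> bB bB'; apply: (@basis_connected (fun B => #|B| = #|B'|) B') bB => //.
move=> {}B e f _ _ eB _ _ fB <-.
by rewrite cardsU1 !inE (negPf fB) andbF (cardsD1 e B) eB.
Qed.

Lemma pair_ex_basis : exists B, basis_of_pair U V B.
Proof.
have [|||B [bB _ _]] := @basis_extend set0 setT.
- by move=> C UC; rewrite subset0; apply: contraTneq UC => ->; case: UV.
- move=> D VD; have [D0|[x xD]] := set_0Vmem D; last by exists x; rewrite ?inE.
  by have := pair_neq0r UV; rewrite -D0 VD.
- exact: sub0set.
by exists B.
Qed.

(** For [x] in C other than [e], the fundamental cocircuit of [x] can meet C only in [x] and [e], so
    it contains [e]. It then meets C' in [e] and once more, necessarily in [x]. Hence C is contained
    in C'. *)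
Lemma basis_circuit_unique B C C' e : basis_of_pair U V B ->
  C \in U -> C' \in U -> C \subset e |: B -> C' \subset e |: B -> e \notin B ->
  C = C'.
Proof.
move=> bB UC UC' sC sC' eB; apply: (pair_antil UV) => //; apply/subsetP=> x xC.
have mem_e A : A \in U -> A \subset e |: B -> e \in A.
  move=> UA sA; have := basis_circuit_trace bB UA sA eB.
  by move/setP/(_ e); rewrite !inE eqxx => /andP[].
have [->|xe] := eqVneq x e; first exact: mem_e.
have xB : x \in B by have := subsetP sC _ xC; rewrite !inE (negPf xe).
have [D VD /andP[xD sD]] :
    exists2 D, D \in V & (x \in D) && (D \subset x |: ~: B).
  have := pair_paint (dual_pairC UV) x (~: B) => -[//|[D UD /andP[xD dD]]].
  have /basis_of_pairP[hU _] := bB; case/negP: (hU _ UD).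
  apply/subsetP=> y yD; move: (disjointFr dD yD); rewrite !inE.
  by case: eqP => [-> _|_ /negbFE].
have [y yx /andP[yC yD]] := pair_meet UV UC VD xC xD.
have ye : y = e.
  have := subsetP sC _ yC; have := subsetP sD _ yD; rewrite !inE (negPf yx) /=.
  by move=> /negPf ->; rewrite orbF => /eqP.
rewrite ye in yD.
have [z ze /andP[zC zD]] := pair_meet UV UC' VD (mem_e _ UC' sC') yD.
have := subsetP sC' _ zC; have := subsetP sD _ zD; rewrite !inE (negPf ze) /=.
by move=> /orP[/eqP <- //|/negPf ->].
Qed.

(** The other alternative of the painting is a cocircuit inside [D :\ b], which the antichain
    property excludes. Such circuits determine the relative sign of a cocircuit at two of its
    elements. *)
Lemma pair_trace2 D a b : D \in V -> a \in D -> b \in D -> a != b ->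
  exists2 C, C \in U & C :&: D = [set a; b].
Proof.
move=> VD aD bD ab; have [[C UC /andP[aC sC]]|] := pair_paint UV a (b |: ~: D).
  exists C => //; have sub x : x \in C -> x \in D -> (x == a) || (x == b).
    by move=> /(subsetP sC); rewrite !inE => /or3P[->//|->|/negPf->//];
      rewrite orbT.
  have [x xa /andP[xC xD]] := pair_meet UV UC VD aC aD.
  have xb : x = b by apply/eqP; have := sub x xC xD; rewrite (negPf xa).
  rewrite {}xb in xC; apply/setP=> y; rewrite !inE; apply/andP/orP.
    by move=> [yC yD]; apply/orP; apply: sub.
  by move=> [/eqP->|/eqP->].
move=> [D' VD' /andP[aD' dD']].
have sD' : D' \subset D.
  apply/subsetP=> x xD'; move: (disjointFr dD' xD'); rewrite !inE.
  by case: eqP => [->|_] //=; case: (x \in D); rewrite // orbT.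
rewrite (pair_antir UV VD' VD sD') in dD'.
by move: (disjointFr dD' bD); rewrite !inE eqxx eq_sym ab.
Qed.

(** Painting with [~: A]: a circuit from the first alternative would meet A in [e] alone. This is
    the tool for finding a cocircuit inside a set that no circuit meets in a single element. *)
Lemma cocircuit_in e (A : {set E}) : e \in A ->
  (forall C, C \in U -> e \in C ->
    exists2 x, x != e & (x \in C) && (x \in A)) ->
  exists2 D, D \in V & (e \in D) && (D \subset A).
Proof.
move=> eA hA; have [[C UC /andP[eC sC]]|] := pair_paint UV e (~: A).
  have [x xe /andP[xC xA]] := hA _ UC eC.
  by have := subsetP sC _ xC; rewrite !inE (negPf xe) xA.
move=> [D VD /andP[eD dD]]; exists D => //; rewrite eD; apply/subsetP=> x xD.
move: (disjointFr dD xD); rewrite !inE; case: eqP => [->|_] //= /negbFE.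
by [].
Qed.

End DualPairTheory2.

Lemma dual_pair_unique (E : finType) (U V V' : {set {set E}}) :
  dual_pair U V -> dual_pair U V' -> V = V'.
Proof.
have ex (W W' : {set {set E}}) D : dual_pair U W -> dual_pair U W' -> D \in W ->
    exists2 D', D' \in W' & D' \subset D.
  move=> UW UW' WD; have [D0|[e eD]] := set_0Vmem D.
    by have := pair_neq0r UW; rewrite -D0 WD.
  have [|D' WD' /andP[_ sD]] := cocircuit_in UW' eD; last by exists D'.
  by move=> C UC eC; have := pair_meet UW UC WD eC eD.
suff sub (W W' : {set {set E}}) : dual_pair U W -> dual_pair U W' ->
  W \subset W'.
  by move=> UV UV'; apply/eqP; rewrite eqEsubset !sub.
move=> UW UW'; apply/subsetP=> D WD.
have [D' WD' sD'] := ex _ _ _ UW UW' WD.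
have [D'' WD'' sD''] := ex _ _ _ UW' UW WD'.
have eqD : D'' = D by apply: (pair_antir UW) => //;
  apply: subset_trans sD'' sD'.
suff -> : D = D' by [].
by apply/eqP; rewrite eqEsubset sD' -{1}eqD sD''.
Qed.

(** * Circuits and cocircuits of the underlying matroid *)

Section UnderlyingMatroidTheory.
Variables (E : finType) (M : oriented_matroid E).
Implicit Types A B C D H I K S : {set E}.
Local Notation U := (ucircuits M).

Lemma mem_ucircuits C : reflect (exists2 X, X \in circuits M & supp X = C) (C \in U).
Proof. by apply: (iffP imsetP) => -[X XM]; exists X. Qed.

Lemma ucircuits_anti C C' : C \in U -> C' \in U -> C \subset C' -> C = C'.
Proof.
move=> /mem_ucircuits[X XM <-] /mem_ucircuits[X' XM' <-] sX.
by have [->|->] := circuits_incomparable XM XM' sX; rewrite ?supp_opp.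
Qed.

Lemma ucircuits_neq0 : set0 \notin U.
Proof.
apply/mem_ucircuits=> -[X XM /supp_eq0 X0].
by have := circuits_neq0 M; rewrite -X0 XM.
Qed.

Lemma circuit_at C e b : C \in U -> e \in C ->
  exists X, [/\ X \in circuits M, supp X = C & X e = Some b].
Proof.
move=> /mem_ucircuits[X XM <-] eX; have [c Xe] := sign_at eX.
have [cb|cb] := eqVneq c b; first by exists X; rewrite Xe cb.
exists (signed_opp X); rewrite circuits_opp ?supp_opp ?signed_oppE ?Xe //.
by split=> //=; case: c b cb {Xe} => [] [].
Qed.

Lemma ucircuits_elim C1 C2 e : C1 \in U -> C2 \in U -> C1 != C2 ->
  e \in C1 -> e \in C2 -> exists2 C, C \in U & C \subset (C1 :|: C2) :\ e.
Proof.
move=> UC1 UC2 C12 e1 e2.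
have [X1 [X1M s1 X1e]] := circuit_at true UC1 e1.
have [X2 [X2M s2 X2e]] := circuit_at false UC2 e2.
have [||Z [ZM Zp Zn]] := circuits_elim X1M X2M (e := e).
- by move=> X12; rewrite -s1 -s2 X12 supp_opp eqxx in C12.
- by rewrite !inE X1e X2e.
exists (supp Z); first by apply/mem_ucircuits; exists Z.
rewrite -s1 -s2; apply/subsetP=> x; rewrite inE => Zx.
have : (x \in pos_part Z) || (x \in neg_part Z).
  by rewrite !inE; case: (Z x) Zx => [[]|].
move=> /orP[/(subsetP Zp)|/(subsetP Zn)]; rewrite !inE => /andP[->
  /orP[]/eqP->];
  by rewrite ?orbT.
Qed.

(** If plain elimination loses [f], its result C3 contains some [g] in C2 but not in C1. Eliminating
    [g] between C2 and C3 while keeping [e] gives C4 without [f] and [g]; then [e] is eliminated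
    between C1 and C4 while keeping [f]. Both unions are smaller, the first without [f], the second
    without [g]. *)
Lemma ucircuits_strong_elim C1 C2 e f : C1 \in U -> C2 \in U ->
  e \in C1 -> e \in C2 -> f \in C1 -> f \notin C2 ->
  exists2 C, C \in U & (f \in C) && (C \subset (C1 :|: C2) :\ e).
Proof.
have [n] := ubnP #|C1 :|: C2|; elim: n C1 C2 e f => // n IHn C1 C2 e f.
rewrite ltnS => leCn UC1 UC2 e1 e2 f1 f2.
have C12 : C1 != C2 by apply: contraNneq f2 => <-.
have [C3 UC3 s3] := ucircuits_elim UC1 UC2 C12 e1 e2.
have [f3|f3] := boolP (f \in C3); first by exists C3; rewrite ?f3.
have [g g3 g1] : exists2 g, g \in C3 & g \notin C1.
  apply/subsetPn; apply: contra f3 => s31.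
  by rewrite (ucircuits_anti UC3 UC1 s31).
have g2 : g \in C2 by have := subsetP s3 _ g3; rewrite !inE (negPf g1) =>
  /andP[].
have e3 : e \notin C3 by apply/negP=> /(subsetP s3); rewrite !inE eqxx.
have s23 : C2 :|: C3 \subset (C1 :|: C2) :\ f.
  rewrite subUset !subsetD1 f2 f3 subsetUr !andbT /=.
  by apply: subset_trans s3 _; apply: subD1set.
have fC12 : f \in C1 :|: C2 by rewrite inE f1.
have [|C4 UC4 /andP[e4 s4]] := IHn C2 C3 g e _ UC2 UC3 g2 g3 e2 e3.
  apply: leq_trans leCn; rewrite (cardsD1 f (C1 :|: C2)) fC12 add1n ltnS.
  exact: subset_leq_card.
have f4 : f \notin C4.
  by apply/negP=> /(subsetP s4); rewrite !inE (negPf f2) (negPf f3) andbF.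
have g4 : g \notin C4 by apply/negP=> /(subsetP s4); rewrite !inE eqxx.
have s4' : C4 \subset C1 :|: C2.
  apply/subsetP=> x /(subsetP s4); rewrite !inE => /andP[_ /orP[->|]].
    by rewrite orbT.
  by move=> /(subsetP s3); rewrite !inE => /andP[_].
have [|C5 UC5 /andP[f5 s5]] := IHn C1 C4 e f _ UC1 UC4 e1 e4 f1 f4.
  apply: leq_trans leCn; rewrite (cardsD1 g (C1 :|: C2)) inE g2 orbT add1n ltnS.
  apply: subset_leq_card.
  by rewrite subUset !subsetD1 g1 g4 s4' subsetUl.
exists C5; rewrite ?f5 //; apply: subset_trans s5 _.
by apply: setSD; rewrite subUset s4' subsetUl.
Qed.

Definition spans S x :=
  (x \in S) || [exists C in U, (x \in C) && (C \subset x |: S)].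

Lemma spansP S x :
  reflect (x \in S \/ exists2 C, C \in U & (x \in C) && (C \subset x |: S))
          (spans S x).
Proof.
apply: (iffP orP) => -[xS|]; try by left.
  by move=> /existsP[C /andP[UC h]]; right; exists C.
by move=> [C UC h]; right; apply/existsP; exists C; rewrite UC.
Qed.

Lemma spansS S S' x : S \subset S' -> spans S x -> spans S' x.
Proof.
move=> sS /spansP[/(subsetP sS) xS|[C UC /andP[xC sC]]]; apply/spansP;
  first by left.
right; exists C => //; rewrite xC; apply: subset_trans sC _; exact: setUS.
Qed.

(** Each [y] of the circuit outside [x |: S] is spanned by S, so strong elimination against a
    circuit of [y |: S], keeping [x], removes it and adds only elements of S. *)
Lemma spans_trans S S' x : (forall y, y \in S' -> spans S y) ->
  spans S' x -> spans S x.
Proof.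
move=> S'S /spansP[/S'S //|[C UC /andP[xC sC]]].
have [xS|xS] := boolP (x \in S); first by apply/spansP; left.
have {sC}hC y : y \in C -> y = x \/ spans S y.
  by move=> /(subsetP sC); rewrite !inE => /orP[/eqP|/S'S]; [left|right].
have [n] := ubnP #|C :\: (x |: S)|; elim: n C UC xC hC =>
  // n IHn C UC xC hC leCn.
have [sC|] := boolP (C \subset x |: S).
  by apply/spansP; right; exists C => //; rewrite xC.
move=> /subsetPn[y yC]; rewrite !inE negb_or => /andP[yx yS].
have [yx'|/spansP[|[C' UC' /andP[yC' sC']]]] := hC y yC.
- by rewrite yx' eqxx in yx.
- by rewrite (negPf yS).
have xC' : x \notin C'.
  by apply/negP=> /(subsetP sC');
    rewrite !inE (negPf xS) orbF eq_sym (negPf yx).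
have [D UD /andP[xD sD]] := ucircuits_strong_elim UC UC' yC yC' xC xC'.
apply: (IHn D) => //.
  move=> z /(subsetP sD); rewrite !inE => /andP[zy /orP[/hC//|]].
  by move=> /(subsetP sC'); rewrite !inE (negPf zy) => zS; right; apply/spansP;
    left.
rewrite -ltnS; apply: leq_trans leCn; rewrite ltnS; apply: proper_card;
  apply/properP; split.
  apply/subsetP=> z; rewrite !inE negb_or => /andP[/andP[zx zS]].
  move=> /(subsetP sD); rewrite !inE zx zS /= => /andP[zy /orP[//|]].
  by move=> /(subsetP sC'); rewrite !inE (negPf zy) (negPf zS).
exists y; first by rewrite !inE yC negb_or yx yS.
rewrite !inE; apply/negP=> /andP[_ /(subsetP sD)].
by rewrite !inE eqxx.
Qed.

Lemma indepP I : reflect (forall C, C \in U -> ~~ (C \subset I)) (indep M I).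
Proof.
apply: (iffP forallP) => h C; first exact: (implyP (h C)).
by apply/implyP; apply: h.
Qed.

Lemma basesP B :
  reflect (indep M B /\ forall x, spans B x) (B \in bases M).
Proof.
rewrite inE; apply: (iffP maxsetP) => -[iB hB]; split=> //.
  move=> x; apply/spansP; have [xB|xB] := boolP (x \in B); [by left|right].
  have : ~~ indep M (x |: B).
    by apply/negP=> /hB/(_ (subsetUr _ _)) eqB; rewrite -eqB !inE eqxx in xB.
  rewrite negb_forall => /existsP[C]; rewrite negb_imply negbK => /andP[UC sC].
  exists C => //; rewrite sC andbT; apply: contraT => xC.
  case/negP: (indepP _ iB _ UC); apply/subsetP=> y yC.
  by have := subsetP sC _ yC; rewrite !inE; case: eqP yC xC => // -> ->.
move=> A /indepP iA sBA; apply/eqP; rewrite eqEsubset sBA andbT.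
apply/subsetP=> x xA; have /spansP[//|[C UC /andP[_ sC]]] := hB x.
case/negP: (iA C UC); apply: subset_trans sC _.
by rewrite subUset sub1set xA.
Qed.

Lemma spanning_basis S : (forall x, spans S x) ->
  exists2 B, B \in bases M & B \subset S.
Proof.
move=> hS; pose p (A : {set E}) := indep M A && (A \subset S).
have p0 : p set0.
  rewrite /p sub0set andbT; apply/indepP=> C UC; rewrite subset0.
  by apply: contraTneq UC => ->; apply: ucircuits_neq0.
have [B /maxsetP[/andP[/indepP iB sB] maxB] _] := maxset_exists p0.
exists B => //; apply/basesP; split=> [|x]; first exact/indepP.
apply: spans_trans (hS x) => y yS; apply/spansP.
have [yB|yB] := boolP (y \in B); [by left|right].
have : ~~ p (y |: B).
  by apply/negP=> /maxB/(_ (subsetUr _ _)) eqB; rewrite -eqB !inE eqxx in yB.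
rewrite /p subUset sub1set yS sB !andbT negb_forall => /existsP[C].
rewrite negb_imply negbK => /andP[UC sC].
exists C => //; rewrite sC andbT; apply: contraT => yC.
case/negP: (iB _ UC); apply/subsetP=> z zC.
by have := subsetP sC _ zC; rewrite !inE; case: eqP zC yC => // -> ->.
Qed.

Lemma mem_ucocircuits D :
  reflect ((forall B, B \in bases M -> exists2 x, x \in D & x \in B) /\
           forall A, (forall B, B \in bases M ->
             exists2 x, x \in A & x \in B) ->
                     A \subset D -> A = D)
          (D \in ucocircuits M).
Proof.
have meetP A : reflect (forall B, B \in bases M -> exists2 x, x \in A & x \in B)
    [forall B in bases M, A :&: B != set0].
  apply: (iffP forallP) => h B.
    by move=> bB; have /set0Pn[x /setIP[xA xB]] := implyP (h B) bB; exists x.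
  by apply/implyP=> /h[x xA xB]; apply/set0Pn; exists x; rewrite inE xA.
rewrite inE; apply: (iffP minsetP) => -[/meetP hD minD]; split=> // A.
  by move=> /meetP hA; apply: minD.
by move=> /meetP hA; apply: minD.
Qed.

Lemma om_dual_pair : dual_pair U (ucocircuits M).
Proof.
have [B0 bB0 _] := @spanning_basis setT (fun x =>
  introT (spansP _ _) (or_introl (in_setT x))).
split.
- exact: ucircuits_neq0.
- by apply/mem_ucocircuits=> -[/(_ _ bB0)[x]]; rewrite inE.
- exact: ucircuits_anti.
- by move=> D D' /mem_ucocircuits[hD _] /mem_ucocircuits[_]; apply.
- move=> C D e UC /mem_ucocircuits[hD minD] eC eD.
  have [/existsP[x /andP[xe xCD]]|/existsPn no] :=
    boolP [exists x, (x != e) && ((x \in C) && (x \in D))]; first by exists x.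
  exfalso.
  have sC : C \subset e |: ~: D.
    by apply/subsetP=> x xC; have := no x; rewrite !inE xC; case: eqP.
  (* By minimality of D some basis must miss [D :\ e]. But if C meets D in [e] only, then [~: D]
     spans [e], so a basis inside [e |: ~: D] yields another one inside [~: D], which misses D. *)
  have [] : ~ (forall B, B \in bases M -> exists2 x, x \in D :\ e & x \in B).
    by move=> /minD/(_ (subD1set _ _))/setP/(_ e); rewrite !inE eqxx eD.
  move=> B bB; have [|/subsetPn[x xB]] := boolP (B \subset e |: ~: D);
    last first.
    by rewrite !inE negb_or negbK => xDe; exists x; rewrite ?inE.
  move=> sB; have [|B' bB' sB'] := @spanning_basis (~: D).
    move=> x; apply: (@spans_trans _ (e |: ~: D)).
      move=> y; rewrite !inE => /orP[/eqP->|yD]; apply/spansP; last by left;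
        rewrite inE.
      by right; exists C; rewrite ?eC.
    by apply: spansS sB _; have /basesP[] := bB.
  by have [x xD /(subsetP sB')] := hD _ bB'; rewrite inE xD.
move=> e K.
have [/spansP[|h]|nK] := boolP (spans (K :\ e) e).
- by rewrite !inE eqxx.
- left; have [C UC /andP[eC sC]] := h; exists C; rewrite // eC.
  apply: subset_trans sC _; apply: setUS; exact: subD1set.
(* A maximal set H that contains [K :\ e] and does not span [e] is a hyperplane; its complement is
   the cocircuit sought. *)
right; pose p (H : {set E}) := ~~ spans H e.
have [H /maxsetP[nH maxH] sKH] := maxset_exists (nK : p _).
have eH : e \notin H by apply: contra nH => eH; apply/spansP; left.
have max_spans x : x \notin H -> spans (x |: H) e.
  move=> xH; apply: contraT => nx; have := maxH _ nx (subsetUr _ _).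
  by move=> eqH; rewrite -eqH !inE eqxx in xH.
exists (~: H); last first.
  by rewrite inE eH disjoints_subset setCS.
apply/mem_ucocircuits; split=> [B bB|A hA sA].
  have [/existsP[x /andP[xH xB]]|/existsPn no] :=
    boolP [exists x, (x \notin H) && (x \in B)].
    by exists x; rewrite ?inE.
  case/negP: nH; apply: (@spansS B); last by have /basesP[] := bB.
  by apply/subsetP=> x xB; have := no x; rewrite xB andbT negbK.
apply/eqP; rewrite eqEsubset sA; apply/subsetP=> d; rewrite inE => dH.
(* Minimality of [~: H]: adding [d] to H spans [e], and with [e] everything else. So [d |: H]
   contains a basis, which A can meet only in [d]. *)
apply: contraT => dA; have [x|B bB sB] := @spanning_basis (d |: H).
  have [xH|xH] := boolP (x \in H); first by apply/spansP; left;
    rewrite inE xH orbT.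
  apply: (@spans_trans _ (e |: H)).
    move=> y; rewrite !inE => /orP[/eqP->|yH]; first exact: max_spans.
    by apply/spansP; left; rewrite inE yH orbT.
  have [xe|xe] := eqVneq x e; first by apply/spansP; left; rewrite xe !inE eqxx.
  have /spansP[|[C UC /andP[eC sC]]] := max_spans x xH.
    by rewrite !inE eq_sym (negPf xe) (negPf eH).
  apply/spansP; right; exists C => //; rewrite setUCA sC andbT.
  apply: contraNT nH => xC; apply/spansP; right; exists C => //; rewrite eC.
  apply/subsetP=> y yC; have := subsetP sC _ yC; rewrite !inE.
  by case: (eqVneq y x) yC xC => [-> ->|].
have [x xA xB] := hA _ bB; have := subsetP sB _ xB; have := subsetP sA _ xA.
by rewrite !inE => /negPf ->; rewrite orbF => /eqP xd; rewrite -xd xA in dA.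
Qed.

Lemma bases_pair B : (B \in bases M) = basis_of_pair U (ucocircuits M) B.
Proof.
apply/idP/basis_of_pairP => [bB|[hU hV]].
  split; first by have /basesP[/indepP] := bB.
  by move=> D /mem_ucocircuits[+ _]; apply.
have bB : basis_of_pair U (ucocircuits M) B by apply/basis_of_pairP.
apply/basesP; split=> [|x]; first exact/indepP.
apply/spansP; have [xB|xB] := boolP (x \in B); [by left|right].
exact: (basis_circuit om_dual_pair bB xB).
Qed.

Lemma rank_basis B : B \in bases M -> rank M = #|B|.
Proof.
rewrite bases_pair => bB; apply/eqP; rewrite eqn_leq; apply/andP; split;
  last first.
  have : indep M B by have := bB; rewrite -bases_pair => /basesP[].
  by move=> iB; rewrite /rank (bigD1 B) //= leq_maxl.
apply/bigmax_leqP=> A /indepP iA.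
have [||B' [bB' sAB' _]] := basis_extend om_dual_pair (S := setT) iA.
- by move=> D VD; have /basis_of_pairP[_ /(_ _ VD)[x]] := bB; exists x.
- exact: subsetT.
by rewrite (basis_card om_dual_pair bB bB'); apply: subset_leq_card.
Qed.

End UnderlyingMatroidTheory.

(** * Signing the cocircuits *)

(** The oriented counterpart of [dual_pair]. Being symmetric in C and D, it carries the duality;
    [signed_pair_om] turns it back into an oriented matroid. *)
Record signed_pair (E : finType) (C D : {set signed_set E}) : Prop :=
  SignedPair {
  signed_oppl : forall X, X \in C -> signed_opp X \in C;
  signed_oppr : forall Y, Y \in D -> signed_opp Y \in D;
  signed_supports : dual_pair [set supp X | X in C] [set supp Y | Y in D];
  signed_orthogonal : forall X Y, X \in C -> Y \in D -> orthogonal X Y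
}.

Lemma signed_pairC (E : finType) (C D : {set signed_set E}) :
  signed_pair C D -> signed_pair D C.
Proof.
case=> h1 h2 h3 h4; split=> //; first exact: dual_pairC.
by move=> X Y DX CY; rewrite orthogonalC h4.
Qed.

Lemma signed_at (E : finType) (S : {set signed_set E}) A e b :
  (forall X, X \in S -> signed_opp X \in S) ->
  A \in [set supp X | X in S] -> e \in A ->
  exists X, [/\ X \in S, supp X = A & X e = Some b].
Proof.
move=> oppS /imsetP[X XS ->] eX; have [c Xe] := sign_at eX.
have [cb|cb] := eqVneq c b; first by exists X; rewrite Xe cb.
exists (signed_opp X); rewrite oppS ?supp_opp ?signed_oppE ?Xe //.
by split=> //=; case: c b cb {Xe} => [] [].
Qed.

(** Circuits that meet the common support in two elements fix the relative signs there. Membership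
    in D concerns the support only, so that a signed set known just by its support and its
    orthogonality can be identified. *)
Lemma signed_unique (E : finType) (C D : {set signed_set E}) Y Y' :
  (forall X, X \in C -> signed_opp X \in C) ->
  dual_pair [set supp X | X in C] [set supp Y | Y in D] ->
  supp Y \in [set supp Y | Y in D] ->
  (forall X, X \in C -> orthogonal X Y) ->
  (forall X, X \in C -> orthogonal X Y') ->
  supp Y = supp Y' -> Y = Y' \/ Y = signed_opp Y'.
Proof.
move=> oppC CD SY oY oY' sY.
have [Y0|[a aY]] := set_0Vmem (supp Y).
  by left; rewrite (supp_eq0 Y0) (supp_eq0 (etrans (esym sY) Y0)).
have step b s : s = Y' \/ s = signed_opp Y' -> Y a = s a -> Y b = s b.
  move=> hs Ya; have [->//|ba] := eqVneq b a.
  have ss : supp s = supp Y by case: hs => ->; rewrite ?supp_opp -sY.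
  have [bY|bY] := boolP (b \in supp Y); last first.
    by rewrite !notin_supp // ss.
  have os X : X \in C -> orthogonal X s.
    by move=> CX; case: hs => ->; rewrite ?orthogonal_oppr oY'.
  have [A SA sA] := pair_trace2 CD SY bY aY ba.
  have [|X [CX sX Xb]] := signed_at true oppC SA (e := b).
    by have /setP/(_ b) := sA; rewrite !inE eqxx => /andP[].
  have aX : X a != zero.
    by rewrite -suppE sX; have /setP/(_ a) := sA; rewrite !inE eqxx orbT =>
      /andP[].
  have ab x : X x != zero -> Y x != zero -> x = a \/ x = b.
    rewrite -!suppE sX => xA xY; have /setP/(_ x) := sA.
    by rewrite !inE xA -suppE xY => /esym/orP[]/eqP; [right|left].
  (* X meets this support in [a] and [b] only, so an orthogonal signing agrees with X at exactly one
     of the two. *)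
  have key Z : (forall X, X \in C -> orthogonal X Z) -> supp Z = supp Y ->
      (X a == Z a) = ~~ (X b == Z b).
    move=> oZ sZ; have sZx x : (Z x != zero) = (Y x != zero) by rewrite -!suppE sZ.
    have Zb : Z b != zero by rewrite sZx -suppE.
    have Za : Z a != zero by rewrite sZx -suppE.
    have Xb0 : X b != zero by rewrite Xb.
    have [Xa|/eqP Xa] := eqVneq (X a) (Z a);
      have [Xb'|/eqP Xb'] := eqVneq (X b) (Z b) => //; exfalso.
      have [x Xx Xx'] := orthogonal_disagree (oZ _ CX) aX Xa.
      have := ab x Xx; rewrite -sZx -sopp_eq0 -Xx' => /(_ Xx)[xa|xb].
        by move: Xx'; rewrite xa -Xa; case: (X a) aX => [[]|].
      by move: Xx'; rewrite xb -Xb' Xb.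
    have Xbo := sopp_neq Xb0 Zb Xb'.
    have [x Xx Xx'] := orthogonal_agree (oZ _ CX) Xb0 Xbo.
    by have := ab x Xx; rewrite -sZx -Xx' => /(_ Xx)[xa|xb];
      [apply: Xa|apply: Xb'];
      rewrite -?xa -?xb.
  have := key Y oY erefl; rewrite Ya (key s os ss) => /negb_inj.
  have Yb0 : Y b != zero by rewrite -suppE.
  have sb0 : s b != zero by rewrite -suppE ss.
  by rewrite Xb; case: (Y b) (s b) Yb0 sb0 => [[]|] [[]|].
have Y'a : a \in supp Y' by rewrite -sY.
have [Ya|Ya] := eqVneq (Y a) (Y' a).
  by left; apply/ffunP=> b; apply: step => //; left.
right; apply/ffunP=> b; apply: step; first by right.
rewrite signed_oppE; apply: sopp_neq; rewrite -?suppE //; exact/eqP.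
Qed.

Section CocircuitSigning.
Variables (E : finType) (M : oriented_matroid E) (D : {set E}).
Hypothesis VD : D \in ucocircuits M.
Implicit Types (B : {set E}) (X Y Z : signed_set E).
Local Notation UV := (om_dual_pair M).

Lemma supp_circuit X : X \in circuits M -> supp X \in ucircuits M.
Proof. by move=> XM; apply/imsetP; exists X. Qed.

Lemma circuits_supp_unique X X' : X \in circuits M -> X' \in circuits M ->
  supp X = supp X' -> X = X' \/ X = signed_opp X'.
Proof. by move=> XM XM' sX; apply: (circuits_incomparable XM XM');
  rewrite sX. Qed.

Lemma elim_at X X' e : X \in circuits M -> X' \in circuits M ->
  X <> signed_opp X' -> X e != zero -> X e = sopp (X' e) ->
  exists Z, [/\ Z \in circuits M, Z e = zero &
    forall x, Z x != zero -> Z x = X x \/ Z x = X' x].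
Proof.
move=> XM XM' XX' X0 Xe.
have conf (P N : {set E}) Z : pos_part Z \subset P :\ e ->
    neg_part Z \subset N :\ e ->
    Z e = zero /\ forall x, (Z x = plus -> x \in P) /\ (Z x = minus -> x \in N).
  move=> /subsetP Zp /subsetP Zn; split=> [|x].
    have := Zp e; have := Zn e; rewrite !inE eqxx /=.
    by case: (Z e) => [[]|] // h1 h2; [have := h2 isT|have := h1 isT].
  by split=> Zx; [have := Zp x|have := Zn x]; rewrite !inE Zx =>
    /(_ isT)/andP[].
case Xs: (X e) X0 => [[]|] // _; rewrite Xs in Xe.
  have [|Z [ZM Zp Zn]] := circuits_elim XM XM' XX' (e := e).
    by rewrite !inE Xs; case: (X' e) Xe => [[]|].
  have [Ze hZ] := conf _ _ _ Zp Zn; exists Z; split=> // x.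
  have [] := hZ x; rewrite !inE; case: (Z x) => [[]|] // h1 h2 _.
    by have /orP[/eqP->|/eqP->] := h1 erefl; [left|right].
  by have /orP[/eqP->|/eqP->] := h2 erefl; [left|right].
have [||Z [ZM Zp Zn]] := circuits_elim XM' XM _ (e := e).
- by move=> X'X; apply: XX'; rewrite X'X signed_oppK.
- by rewrite !inE Xs; case: (X' e) Xe => [[]|].
have [Ze hZ] := conf _ _ _ Zp Zn; exists Z; split=> // x.
have [] := hZ x; rewrite !inE; case: (Z x) => [[]|] // h1 h2 _.
  by have /orP[/eqP->|/eqP->] := h1 erefl; [right|left].
by have /orP[/eqP->|/eqP->] := h2 erefl; [right|left].
Qed.

Lemma meet_cocircuit X e : X \in circuits M -> X e != zero -> e \in D ->
  exists x, [/\ x != e, X x != zero & x \in D].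
Proof.
move=> XM; rewrite -suppE => eX eD.
have [x xe /andP[xX xD]] := pair_meet UV (supp_circuit XM) VD eX eD.
by exists x; rewrite -suppE.
Qed.

(** Such a basis is [b] together with a basis of the hyperplane [~: D]. The prescribed part is
    circuit-free because it omits the second element in which X meets D. *)
Lemma basis_near X b : X \in circuits M -> X b != zero -> b \in D ->
  exists B, [/\ B \in bases M, B :&: D = [set b] &
    forall x, X x != zero -> x \notin D -> x \in B].
Proof.
move=> XM Xb bD; pose I := b |: (supp X :\: D).
have [|||B [bB sI sB]] := @basis_extend _ _ _ UV I (b |: ~: D).
- move=> C UC; apply/negP=> sC; have sCX : C \subset supp X.
    apply/subsetP=> x /(subsetP sC); rewrite !inE => /orP[/eqP->//|].
    by case/andP.
  have [x [xb Xx xD]] := meet_cocircuit XM Xb bD.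
  have := subsetP sC x; rewrite (ucircuits_anti UC (supp_circuit XM) sCX).
  by rewrite !inE Xx (negPf xb) xD => /(_ isT).
- move=> D' VD'; apply/exists_inP; apply: contraT => /exists_inPn no.
  have sD : D' \subset D.
    by apply/subsetP=> x /no; rewrite !inE negb_or negbK => /andP[].
  have := no b; rewrite (pair_antir UV VD' VD sD) => /(_ bD).
  by rewrite !inE eqxx.
- by apply: setUS; apply/subsetP=> x; rewrite !inE => /andP[].
exists B; rewrite bases_pair; split=> //.
  apply/setP=> x; rewrite !inE; apply/andP/eqP=> [[/(subsetP sB)]|->].
    by rewrite !inE => /orP[/eqP//|/negPf->].
  by split=> //; apply: (subsetP sI); rewrite !inE eqxx.
by move=> x Xx xD; apply: (subsetP sI); rewrite !inE Xx xD orbT.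
Qed.

Definition trace_at (a b : E) X := supp X :&: D == [set a; b].

Lemma trace_atP a b X : trace_at a b X ->
  [/\ X a != zero, X b != zero & forall x, X x != zero -> x \in D ->
    x = a \/ x = b].
Proof.
move=> /eqP/setP tX; split.
- by have := tX a; rewrite !inE eqxx => /andP[].
- by have := tX b; rewrite !inE eqxx orbT => /andP[].
by move=> x Xx xD; have := tX x; rewrite !inE Xx xD => /esym/orP[]/eqP;
  [left|right].
Qed.

Lemma trace_in_basis a B b X : B \in bases M -> B :&: D = [set a] -> b != a ->
  trace_at a b X -> (forall x, X x != zero -> x \notin D -> x \in B) ->
  supp X \subset b |: B.
Proof.
move=> bB aB ba /trace_atP[_ _ tX] sX; apply/subsetP=> x.
rewrite suppE !inE => Xx; have [xD|xD] := boolP (x \in D);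
  last by rewrite sX ?orbT.
have [->|->] := tX x Xx xD; last by rewrite eqxx.
by have /setP/(_ a) := aB; rewrite !inE eqxx => /andP[->]; rewrite orbT.
Qed.

Lemma trace_ex a B b : B \in bases M -> B :&: D = [set a] -> b \in D ->
  b != a ->
  exists X, [/\ X \in circuits M, supp X \subset b |: B & trace_at a b X].
Proof.
move=> bB aB bD ba; have bBp := bB; rewrite bases_pair in bBp.
have aDB x : x \in B -> x \in D -> x = a.
  by move=> xB xD; have /setP/(_ x) := aB; rewrite !inE xB xD => /esym/eqP.
have bnB : b \notin B by apply: contraNN ba => /aDB/(_ bD) ->.
have [C UC /andP[bC sC]] := basis_circuit UV bBp bnB.
have [X [XM sX _]] := circuit_at true UC bC.
exists X; rewrite sX; split=> //; rewrite /trace_at sX.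
have sub x : x \in C -> x \in D -> x = a \/ x = b.
  move=> /(subsetP sC); rewrite !inE => /orP[/eqP->|xB xD]; first by right.
  by left; apply: aDB.
have [x xb /andP[xC xD]] := pair_meet UV UC VD bC bD.
have aC : a \in C by case: (sub x xC xD) xb => [<-|->] //; rewrite eqxx.
have aD : a \in D by have /setP/(_ a) := aB; rewrite !inE eqxx => /andP[].
apply/eqP/setP=> y; rewrite !inE; apply/andP/orP=> [[yC yD]|[]/eqP->//].
by case: (sub y yC yD) => ->; [left|right].
Qed.

Variable a : E.
Hypothesis aD : a \in D.

(** Suppose the signs at [b] differ. Eliminate [b] from X and X' to get Z, and [a] from X and the
    opposite of X' to get Z'. Both then miss D at [a] and [b], since a circuit cannot meet D once,
    so both lie in [f |: B] and have the same support. At a point where X' vanishes both carry the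
    sign of X; where X vanishes they carry opposite signs. So Z is neither Z' nor its opposite. *)
Lemma trace_sign_step B b e f X X' : b \in D -> b != a ->
  B \in bases M -> f |: (B :\ e) \in bases M ->
  B :&: D = [set a] -> (f |: (B :\ e)) :&: D = [set a] -> f \notin B ->
  X \in circuits M -> X' \in circuits M ->
  supp X \subset b |: B -> supp X' \subset b |: (f |: (B :\ e)) ->
  trace_at a b X -> trace_at a b X' -> X a = X' a -> X b = X' b.
Proof.
move=> bD ba bB bB' aB aB' fB XM XM' sX sX' tX tX' Xa.
have [Xa0 Xb0 hX] := trace_atP tX; have [Xa0' Xb0' hX'] := trace_atP tX'.
apply/eqP; apply: contraT => /eqP Xb; have Xbo := sopp_neq Xb0 Xb0' Xb.
have XX' : X <> signed_opp X'.
  by move=> eqX; move: Xa; rewrite eqX signed_oppE; case: (X' a) Xa0' => [[]|].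
have XX'o : X <> signed_opp (signed_opp X').
  by rewrite signed_oppK => eqX; rewrite eqX in Xb.
have [Z [ZM Zb hZ]] := elim_at XM XM' XX' Xb0 Xbo.
have [|Z' [ZM' Za' hZ']] := elim_at XM (circuits_opp XM') XX'o Xa0.
  by rewrite signed_oppE soppK.
have {}hZ' x : Z' x != zero -> Z' x = X x \/ Z' x = sopp (X' x).
  by rewrite -signed_oppE; apply: hZ'.
have near W c c' : W \in circuits M -> c \in D -> W c = zero ->
    (c = a /\ c' = b) \/ (c = b /\ c' = a) ->
    (forall x, W x != zero -> X x != zero \/ X' x != zero) ->
    (forall x, W x != zero -> x != a /\ x != b).
  move=> WM cD Wc cc' hW.
  have inD x : W x != zero -> x \in D -> x = c'.
    move=> Wx xD; have xab : x = a \/ x = b.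
      by have [/hX|/hX'] := hW x Wx; apply.
    have xc : x <> c by move=> xc; rewrite xc Wc in Wx.
    by case: cc' xab => -[cE ->] [] // xab; case: xc; rewrite cE.
  have c'D : c' \in D by case: cc' => -[_ ->].
  have Wc' : W c' = zero.
    apply/eqP; apply: contraT => Wc'.
    have [x [xc' Wx xD]] := meet_cocircuit WM Wc' c'D.
    by rewrite (inD x Wx xD) eqxx in xc'.
  move=> x Wx; split; apply: contraNneq Wx => ->; apply/eqP;
    by case: cc' Wc Wc' => -[-> ->].
have subB W : W \in circuits M -> 
    (forall x, W x != zero -> X x != zero \/ X' x != zero) ->
    (forall x, W x != zero -> x != a /\ x != b) -> supp W \subset f |: B.
  move=> WM hW nW; apply/subsetP=> x; rewrite suppE => Wx.
  have [xa xb] := nW x Wx; have [|] := hW x Wx; rewrite -suppE.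
    by move=> /(subsetP sX); rewrite !inE (negPf xb) /= => ->; rewrite orbT.
  move=> /(subsetP sX'); rewrite !inE (negPf xb) /= => /orP[->//|/andP[_ ->]].
  by rewrite orbT.
have ZX x : Z x != zero -> X x != zero \/ X' x != zero.
  by move=> Zx; case: (hZ x Zx) => <-; [left|right].
have ZX' x : Z' x != zero -> X x != zero \/ X' x != zero.
  by move=> Zx; case: (hZ' x Zx) => Z'x; [left|right; rewrite -sopp_eq0];
    rewrite -Z'x.
have nZ := near _ _ _ ZM bD Zb (or_intror (conj erefl erefl)) ZX.
have nZ' := near _ _ _ ZM' aD Za' (or_introl (conj erefl erefl)) ZX'.
have sZZ' : supp Z = supp Z'.
  have bBp := bB; rewrite bases_pair in bBp.
  apply: (basis_circuit_unique UV bBp _ _ _ _ fB); first exact: supp_circuit.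
  - exact: supp_circuit.
  - exact: subB ZX nZ.
  - exact: subB ZX' nZ'.
have other W : W \in circuits M -> W a != zero ->
  exists2 x, Z x != zero & W x = zero.
  move=> WM Wa; have : ~~ (supp Z \subset supp W).
    apply/negP=> sZW; have :=
      ucircuits_anti (supp_circuit ZM) (supp_circuit WM) sZW.
    move=> /setP/(_ a); rewrite !suppE Wa => /nZ[]; first by rewrite eqxx.
  by move=> /subsetPn[x]; rewrite !suppE negbK => Zx /eqP Wx; exists x.
have [s Zs X's] := other _ XM' Xa0'; have [t Zt Xt] := other _ XM Xa0.
have Zs' : Z' s != zero by rewrite -suppE -sZZ' suppE.
have Zt' : Z' t != zero by rewrite -suppE -sZZ' suppE.
have e1 : Z s = X s by case: (hZ _ Zs) => // Z0; rewrite Z0 X's in Zs.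
have e2 : Z t = X' t by case: (hZ _ Zt) => // Z0; rewrite Z0 Xt in Zt.
have e3 : Z' s = X s by case: (hZ' _ Zs') => // Z0; rewrite Z0 X's in Zs'.
have e4 : Z' t = sopp (X' t) by case: (hZ' _ Zt') => // Z0;
  rewrite Z0 Xt in Zt'.
case: (circuits_supp_unique ZM ZM' sZZ') => eqZ.
  by move: e2; rewrite eqZ e4; case: (X' t) e4 Zt' => [[]|] // ->.
by move: e1; rewrite eqZ signed_oppE e3; case: (X s) e3 Zs' => [[]|] // ->.
Qed.

(** Exchanges lead from a basis near X to one near X'. They keep [a] and only bring in elements of
    the final basis, so every intermediate basis meets D in [a] alone and carries a circuit with the
    same trace; neighbours are compared by [trace_sign_step]. *)
Lemma trace_sign b X X' : b \in D -> b != a -> X \in circuits M ->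
  X' \in circuits M -> trace_at a b X -> trace_at a b X' -> X a = X' a ->
    X b = X' b.
Proof.
move=> bD ba XM XM' tX tX' Xa.
have [Xa0 _ _] := trace_atP tX; have [Xa0' _ _] := trace_atP tX'.
have [B [bB aB sB]] := basis_near XM Xa0 aD.
have [B' [bB' aB' sB']] := basis_near XM' Xa0' aD.
have bBp := bB; have bBp' := bB'; rewrite !bases_pair in bBp bBp'.
have {sB}sX := trace_in_basis bB aB ba tX sB.
have {sB'}sX' := trace_in_basis bB' aB' ba tX' sB'.
pose P B := B :&: D = [set a] -> forall X, X \in circuits M ->
  supp X \subset b |: B -> trace_at a b X -> X a = X' a -> X b = X' b.
suff : P B by apply.
apply: (@basis_connected _ _ _ UV P B' _ bBp' _ B bBp).
  move=> _ {XM sX tX Xa Xa0}X XM sX tX Xa.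
  have bnB : b \notin B'.
    apply: contraNN ba => bB'0; have /setP/(_ b) := aB'.
    by rewrite !inE bB'0 bD => /esym.
  have sXX' : supp X = supp X'.
    by apply: (basis_circuit_unique UV bBp' _ _ _ _ bnB) => //;
      apply: supp_circuit.
  have [->//|eqX] := circuits_supp_unique XM XM' sXX'.
  by move: Xa; rewrite eqX !signed_oppE; case: (X' a) Xa0' => [[]|].
move=> B1 e f bB1 bB2 eB1 eB' fB' fB1 IH aB1 X1 XM1 sX1 tX1 Xa1.
rewrite -!bases_pair in bB1 bB2.
have aBx x B0 : B0 :&: D = [set a] -> x \in B0 -> x \in D -> x = a.
  by move=> /setP/(_ x); rewrite !inE => + x0 xD; rewrite x0 xD => /esym/eqP.
have aB1' : a \in B1 by have /setP/(_ a) := aB1; rewrite !inE eqxx => /andP[].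
have aB'' : a \in B' by have /setP/(_ a) := aB'; rewrite !inE eqxx => /andP[].
have ae : a != e by apply: contraNneq eB' => <-.
have aB2 : (f |: (B1 :\ e)) :&: D = [set a].
  apply/setP=> x; rewrite !inE; apply/andP/eqP=>
    [[/orP[/eqP->|/andP[_ xB1]] xD]|->].
  - exact: (aBx _ _ aB' fB' xD).
  - exact: (aBx _ _ aB1 xB1 xD).
  by rewrite aB1' ae orbT.
have [X2 [XM2 sX2 tX2]] := trace_ex bB2 aB2 bD ba.
have [Xa2 _ _] := trace_atP tX2.
wlog Xa2' : X2 XM2 sX2 tX2 Xa2 / X2 a = X' a.
  move=> hw; have [|Xa2'] := eqVneq (X2 a) (X' a); first exact: hw.
  apply: (hw (signed_opp X2));
    rewrite ?circuits_opp ?supp_opp ?signed_oppE ?sopp_eq0 //.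
    by rewrite /trace_at supp_opp.
  by case: (X2 a) (X' a) Xa2 Xa0' Xa2' => [[]|] [[]|].
rewrite -(IH aB2 _ XM2 sX2 tX2 Xa2').
apply: (trace_sign_step bD ba bB1 bB2 aB1 aB2 fB1 XM1 XM2 sX1 sX2 tX1 tX2).
by rewrite Xa1.
Qed.

(** Normalised to + at [a]; orthogonality to a circuit meeting D in [a] and [b] only then forces the
    sign at [b]. The default [zero] is reached exactly outside D. *)
Definition cocircuit_signing : signed_set E := [ffun b =>
  if b == a then plus else
  if [pick X in circuits M | trace_at a b X && (X a == plus)] is Some X
  then sopp (X b) else zero].

Lemma cocircuit_signing_at : cocircuit_signing a = plus.
Proof. by rewrite ffunE eqxx. Qed.

Lemma cocircuit_signing_trace b X : b \in D -> b != a -> X \in circuits M ->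
  trace_at a b X -> X a = plus -> cocircuit_signing b = sopp (X b).
Proof.
move=> bD ba XM tX Xa; rewrite ffunE (negPf ba).
case: pickP => [X' /and3P[XM' tX' /eqP Xa']|/(_ X)]; last by rewrite XM tX Xa.
by congr sopp; apply: trace_sign => //; rewrite Xa.
Qed.

Lemma trace_ex_plus b : b \in D -> b != a ->
  exists X, [/\ X \in circuits M, trace_at a b X & X a = plus].
Proof.
move=> bD ba; have ab : a != b by rewrite eq_sym.
have [C UC tC] := pair_trace2 UV VD aD bD ab.
have aC : a \in C by have /setP/(_ a) := tC; rewrite !inE eqxx => /andP[].
have [X [XM sX Xa]] := circuit_at true UC aC.
by exists X; rewrite /trace_at sX tC.
Qed.

Lemma supp_cocircuit_signing : supp cocircuit_signing = D.
Proof.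
apply/setP=> b; rewrite suppE; have [->|ba] := eqVneq b a.
  by rewrite cocircuit_signing_at aD.
have [bD|bD] := boolP (b \in D).
  have [X [XM tX Xa]] := trace_ex_plus bD ba.
  rewrite (cocircuit_signing_trace bD ba XM tX Xa) sopp_eq0.
  by have [_ ->] := trace_atP tX.
rewrite ffunE (negPf ba); case: pickP => [X /and3P[_ /eqP/setP/(_ b)]|];
  last by rewrite eqxx.
by rewrite !inE eqxx orbT (negPf bD) andbF.
Qed.

(* Induction on the number of elements of X in D other than a: one of them is
   eliminated against a circuit meeting D in it and a only. *)
Lemma cocircuit_signing_disagree X e : X \in circuits M -> X e != zero ->
  X e = cocircuit_signing e ->
  exists2 x, X x != zero & X x = sopp (cocircuit_signing x).
Proof.
set Y := cocircuit_signing => XM Xe0 Xe.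
have YD x : (Y x != zero) = (x \in D) by rewrite -suppE supp_cocircuit_signing.
suff no n Z : #|(supp Z :&: D) :\ a| < n -> Z \in circuits M ->
    (forall x, Z x != zero -> x \in D -> Z x = Y x) ->
    forall x, Z x != zero -> x \in D -> False.
  have [/existsP[x /andP[Xx /eqP XY]]|/existsPn nX] :=
    boolP [exists x, (X x != zero) && (X x == sopp (Y x))]; first by exists x.
  exfalso; apply: (no _ X (leqnn _) XM _ e Xe0); last by rewrite -YD -Xe.
  move=> x Xx xD; apply/eqP; apply: contraT => /eqP nXY.
  by have := nX x; rewrite Xx => /eqP[]; apply: sopp_neq; rewrite ?YD.
elim: n Z => // n IHn Z ltn ZM ZY x Zx xD.
have [b [bD ba Zb]] : exists b, [/\ b \in D, b != a & Z b != zero].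
  have [y [yx Zy yD]] := meet_cocircuit ZM Zx xD.
  have [xa|xa] := eqVneq x a; last by exists x.
  by exists y; rewrite -xa.
have [tZ|tZ] := boolP (trace_at a b Z).
  have [Za _ _] := trace_atP tZ; have := ZY a Za aD.
  rewrite /Y cocircuit_signing_at => /(cocircuit_signing_trace bD ba ZM tZ).
  by rewrite -/Y -(ZY b Zb bD); case: (Z b) Zb => [[]|].
have [B [bB bBD sB]] := basis_near ZM Zb bD.
have ab : a != b by rewrite eq_sym.
have [X1 [XM1 sX1 tX1]] := trace_ex bB bBD aD ab.
have [X1b X1a hX1] := trace_atP tX1.
wlog X1b' : X1 XM1 sX1 tX1 X1b X1a hX1 / X1 b = sopp (Z b).
  move=> hw; have [|X1b'] := eqVneq (X1 b) (sopp (Z b)); first exact: hw.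
  have XM1' := circuits_opp XM1; apply: (hw _ XM1').
  - by rewrite supp_opp.
  - by rewrite /trace_at supp_opp.
  - by rewrite signed_oppE sopp_eq0.
  - by rewrite signed_oppE sopp_eq0.
  - by move=> y; rewrite signed_oppE sopp_eq0; apply: hX1.
  by rewrite signed_oppE; case: (X1 b) (Z b) X1b X1b' Zb => [[]|] [[]|].
have tX1' : trace_at a b X1 by rewrite /trace_at setUC.
(* X1 is opposite to Y at [b], the element to be eliminated, so by the construction of Y it agrees
   with Y at [a]. Hence W still agrees with Y on D. *)
have X1aY : X1 a = Y a.
  rewrite /Y cocircuit_signing_at; case X1p: (X1 a) X1a => [[]|] // _.
  have := cocircuit_signing_trace bD ba (circuits_opp XM1).
  rewrite signed_oppE X1p /trace_at supp_opp signed_oppE X1b' soppK -/Y.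
  by move=> /(_ tX1' erefl); rewrite -(ZY b Zb bD); case: (Z b) Zb => [[]|].
have ZX1 : Z <> signed_opp X1.
  by move=> eqZ; move: tZ; rewrite eqZ /trace_at supp_opp; case/negP.
have Zb' : Z b = sopp (X1 b) by rewrite X1b' soppK.
have [W [WM Wb hW]] := elim_at ZM XM1 ZX1 Zb Zb'.
have {}hW y : W y != zero ->
  y != b /\ (Z y != zero /\ W y = Z y \/ X1 y != zero /\ W y = X1 y).
  move=> Wy; split; first by apply: contraNneq Wy => ->; rewrite Wb.
  by case: (hW y Wy) => eqW; [left|right]; rewrite -eqW.
have hX1D y : X1 y != zero -> y \in D -> y != b -> y = a.
  by move=> h1 h2 yb; case: (hX1 y h1 h2) yb => [->|//]; rewrite eqxx.
(* W still meets D: outside D its elements come from Z or X1 and lie in the basis B, which contains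
   no circuit. *)
have : ~~ (supp W \subset B).
  by have /basesP[/indepP iB _] := bB; apply: iB; apply: supp_circuit.
move=> /subsetPn[y]; rewrite suppE => Wy yB.
have yD : y \in D.
  apply: contraT => yD; have [yb [[Zy _]|[X1y _]]] := hW y Wy.
    by rewrite (sB y Zy yD) in yB.
  have := subsetP sX1 y; rewrite suppE X1y !inE (negPf yB) orbF =>
    /(_ isT)/eqP ya.
  by rewrite ya aD in yD.
apply: (IHn W _ WM _ y Wy yD).
  rewrite -ltnS; apply: leq_trans ltn; rewrite ltnS; apply: proper_card.
  apply/properP; split.
    apply/subsetP=> z; rewrite !inE => /and3P[za Wz zD]; rewrite za zD andbT /=.
    have [zb [[//]|[X1z _]]] := hW z Wz.
    by rewrite (hX1D z X1z zD zb) eqxx in za.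
  by exists b; rewrite !inE ?Wb ?eqxx ?andbF ?ba ?Zb ?bD.
move=> z Wz zD; have [zb [[Zz ->]|[X1z ->]]] := hW z Wz; first exact: ZY.
by rewrite (hX1D z X1z zD zb).
Qed.

Lemma cocircuit_signing_orthogonal X : X \in circuits M ->
  orthogonal X cocircuit_signing.
Proof.
move=> XM; apply: orthogonal_intro => e Xe0 Xe.
  exact: cocircuit_signing_disagree Xe0 Xe.
have [||x] := @cocircuit_signing_disagree (signed_opp X) e (circuits_opp XM).
- by rewrite signed_oppE sopp_eq0.
- by rewrite signed_oppE Xe soppK.
rewrite signed_oppE sopp_eq0 => Xx /(congr1 sopp).
by rewrite !soppK => Xx'; exists x.
Qed.

End CocircuitSigning.

Lemma om_signed_pair (E : finType) (M : oriented_matroid E) :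
  signed_pair (circuits M) (cocircuits M).
Proof.
split.
- by move=> X; apply: circuits_opp.
- move=> Y; rewrite !inE supp_opp => /andP[-> /forallP oY] /=.
  by apply/forallP=> X; rewrite orthogonal_oppr.
- have <- : ucocircuits M = [set supp Y | Y in cocircuits M];
  last exact: om_dual_pair.
  apply/setP=> D; apply/idP/imsetP=> [VD|[Y]]; last by rewrite inE =>
    /andP[? _] ->.
  have [D0|[a aD]] := set_0Vmem D.
    by have := pair_neq0r (om_dual_pair M); rewrite -D0 VD.
  exists (cocircuit_signing M D a); last by rewrite supp_cocircuit_signing.
  rewrite inE supp_cocircuit_signing // VD /=; apply/forallP=> X; apply/implyP.
  exact: cocircuit_signing_orthogonal.
move=> X Y XM; rewrite inE => /andP[_ /forallP/(_ X)]; rewrite XM; exact.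
Qed.

(** * Painting and duality *)

Section Painting.
Variable E : finType.
Implicit Types (X Y Z : signed_set E) (P Q : {set E}).

(* P (resp. Q) collects the elements at which a circuit is allowed to be
   positive (resp. negative); a cocircuit must then avoid being positive on Q
   or negative on P.  The root r is exempt. *)
Definition circuit_fits P Q r X := forall x, x != r ->
  (X x = plus -> x \in P) /\ (X x = minus -> x \in Q).

Definition cocircuit_fits P Q r Y := forall x, x != r ->
  (Y x = plus -> x \notin Q) /\ (Y x = minus -> x \notin P).

Variables (C D : {set signed_set E}) (r : E) (b : bool).
Hypothesis orthCD : forall X Y, X \in C -> Y \in D -> orthogonal X Y.
Hypothesis paint0 : forall K : {set E},
  (exists X, [/\ X \in C, X r = Some b & supp X \subset r |: K]) \/
  (exists Y, [/\ Y \in D, Y r = Some b & [disjoint supp Y & K :\ r]]).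

(* Induction on the number of elements in only one of P and Q: if allowing both
   signs (resp. no sign) at p only yields a circuit (resp. a cocircuit) with the
   forbidden sign at p, these two violate orthogonality. *)
Lemma painting P Q :
  (exists X, [/\ X \in C, X r = Some b & circuit_fits P Q r X]) \/
  (exists Y, [/\ Y \in D, Y r = Some b & cocircuit_fits P Q r Y]).
Proof.
have [n] := ubnP #|[set x | (x != r) && ((x \in P) (+) (x \in Q))]|.
elim: n P Q => // n IHn P Q ltn.
have [/existsP[p /andP[pr pPQ]]|/existsPn eqPQ] :=
  boolP [exists x, (x != r) && ((x \in P) (+) (x \in Q))]; last first.
  have [[X [CX Xr sX]]|[Y [DY Yr dY]]] := paint0 P; [left; exists X|right;
    exists Y];
    split=> // x xr; have := eqPQ x; rewrite xr negb_add /= => /eqP PQ.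
    suff: X x != zero -> x \in P by rewrite -PQ; case: (X x) => [[]|] // ->.
    by rewrite -suppE => /(subsetP sX); rewrite !inE (negPf xr).
  suff: Y x != zero -> x \notin P by rewrite -PQ; case: (Y x) => [[]|] // ->.
  by rewrite -suppE => /(disjointFr dY); rewrite !inE xr /= => ->.
have lt' P' Q' : P' :\ p = P :\ p -> Q' :\ p = Q :\ p ->
  (p \in P') = (p \in Q') ->
    #|[set x | (x != r) && ((x \in P') (+) (x \in Q'))]| < n.
  move=> PP QQ eqp; rewrite -ltnS; apply: leq_trans ltn; rewrite ltnS.
  apply: proper_card; apply/properP; split; last first.
    by exists p; rewrite !inE ?pr ?eqp ?addbb.
  apply/subsetP=> x; rewrite !inE => /andP[-> /=].
  have [->|xp] := eqVneq x p; first by rewrite eqp addbb.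
  have := congr1 (fun A : {set E} => x \in A) PP.
  have := congr1 (fun A : {set E} => x \in A) QQ.
  by rewrite /= !inE xp /= => -> ->.
have addD1 (A : {set E}) : (p |: A) :\ p = A :\ p.
  by apply/setP=> x; rewrite !inE; case: eqP.
have D1D1 (A : {set E}) : (A :\ p) :\ p = A :\ p.
  by apply/setP=> x; rewrite !inE; case: eqP.
have [|[X [CX Xr fX]]|[Y [DY Yr fY]]] := IHn (p |: P) (p |: Q).
- by apply: lt'; rewrite ?addD1 // !inE eqxx.
- have [fXp|nfX] := boolP (((X p == plus) ==> (p \in P)) && ((X p == minus) ==>
  (p \in Q))).
    left; exists X; split=> // x xr; have [X1 X2] := fX x xr.
    move: X1 X2; rewrite !inE; have [->|//] := eqVneq x p.
    by move=> _ _; have /andP[/implyP h1 /implyP h2] := fXp; split=> /eqP.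
  have [|[X' [CX' Xr' fX']]|[Y [DY Yr fY]]] := IHn (P :\ p) (Q :\ p).
  + by apply: lt'; rewrite ?D1D1 // !inE eqxx.
  + left; exists X'; split=> // x xr; have [X1 X2] := fX' x xr.
    by split=> [/X1|/X2]; rewrite inE => /andP[].
  have [fYp|nfY] := boolP (((Y p == plus) ==>
    (p \notin Q)) && ((Y p == minus) ==> (p \notin P))).
    right; exists Y; split=> // x xr; have [Y1 Y2] := fY x xr.
    move: Y1 Y2; rewrite !inE; have [->|//] := eqVneq x p.
    by move=> _ _; have /andP[/implyP h1 /implyP h2] := fYp; split=> /eqP.
  exfalso; have Xr0 : X r != zero by rewrite Xr.
  have [|x Xx XY] := orthogonal_disagree (orthCD CX DY) Xr0;
    first by rewrite Xr Yr.
  have [xp|xp] := eqVneq x p.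
    move: nfX nfY pPQ Xx XY; rewrite xp.
    by case: (X p) (Y p) (p \in P) (p \in Q) => [[]|] [[]|] [] [].
  have [xr|xr] := eqVneq x r; first by move: XY; rewrite xr Xr Yr; case: (b).
  have [X1 X2] := fX x xr; have [Y1 Y2] := fY x xr; move: X1 X2 Y1 Y2 Xx XY.
  rewrite !inE (negPf xp) /=.
  by case: (X x) (Y x) (x \in P) (x \in Q) =>
    [[]|] [[]|] [] [] //= h1 h2 h3 h4 _ _;
    first [by have := h1 erefl | by have := h2 erefl | by have := h3 erefl |
      by have := h4 erefl].
right; exists Y; split=> // x xr; have [Y1 Y2] := fY x xr.
by split=> [/Y1|/Y2]; rewrite inE negb_or => /andP[].
Qed.

End Painting.

(** * Elimination from painting *)

Section Elimination.
Variable E : finType.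
Implicit Types (X Y Z : signed_set E) (P Q : {set E}).

Definition pos_union X1 X2 e : {set E} := (pos_part X1 :|: pos_part X2) :\ e.
Definition neg_union X1 X2 e : {set E} := (neg_part X1 :|: neg_part X2) :\ e.

Lemma fits_union X1 X2 e Y r x : x != e -> x != r ->
  cocircuit_fits (pos_union X1 X2 e) (neg_union X1 X2 e) r Y ->
  (X1 x != zero -> X1 x = sopp (Y x) -> False) /\
  (X2 x != zero -> X2 x = sopp (Y x) -> False).
Proof.
move=> xe xr fY; have [] := fY x xr; rewrite !inE xe /=.
case: (X1 x) (X2 x) (Y x) => [[]|] [[]|] [[]|] //= h1 h2; split=> //.
all: by first [by have := h1 erefl | by have := h2 erefl].
Qed.

Variables (C D : {set signed_set E}).
Hypothesis orthCD : forall X Y, X \in C -> Y \in D -> orthogonal X Y.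

(** As [sopp] fixes zero, the condition at [a] excludes two zeros as well as opposite signs; so one
    sign [b] is right for both. If painting returns a cocircuit Y, it opposes X1 and X2 at most at
    [e]. Agreeing with one of them at [a], it must be nonzero at [e]; but then it agrees at [e] with
    the X1 or X2 of that sign and opposes it nowhere. Painting is required at the root [a] only,
    which is all that is known in an extension. *)
Lemma strong_elimination X1 X2 e a :
  (forall b P Q,
    (exists X, [/\ X \in C, X a = Some b & circuit_fits P Q a X]) \/
    (exists Y, [/\ Y \in D, Y a = Some b & cocircuit_fits P Q a Y])) ->
  X1 \in C -> X2 \in C -> X1 e = plus -> X2 e = minus ->
  X1 a != sopp (X2 a) ->
  exists Z, [/\ Z \in C, Z a != zero, pos_part Z \subset pos_union X1 X2 e &
    neg_part Z \subset neg_union X1 X2 e].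
Proof.
move=> paint CX1 CX2 X1e X2e Xa.
have ae : a != e by apply: contraNneq Xa => ->; rewrite X1e X2e.
pose P := pos_union X1 X2 e; pose Q := neg_union X1 X2 e.
have [b [ab hb]] : exists b, (a \in (if b then P else Q)) /\
    forall s, X1 a = s \/ X2 a = s -> s != zero -> s = Some b.
  exists ((X1 a == plus) || (X2 a == plus)); split; move: Xa.
    by case: ifP; rewrite !inE ae /=; case: (X1 a) (X2 a) => [[]|] [[]|].
  by case: (X1 a) (X2 a) => [[]|] [[]|] //= _ s [] <-.
have [[Z [CZ Za fZ]]|[Y [DY Ya fY]]] := paint b P Q.
  exists Z; rewrite Za; split=> //; apply/subsetP=> x; rewrite inE => /eqP Zx.
    have [xa|xa] := eqVneq x a; last by have [+ _] := fZ x xa; apply.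
    by move: ab; rewrite xa; move: Za; rewrite -xa Zx => -[<-].
  have [xa|xa] := eqVneq x a; last by have [_ +] := fZ x xa; apply.
  by move: ab; rewrite xa; move: Za; rewrite -xa Zx => -[<-].
exfalso.
have dis1 x : X1 x != zero -> X1 x = sopp (Y x) -> x = e.
  move=> X1x XY; apply/eqP; apply: contraT => xe.
  have [xa|xa] := eqVneq x a; last by have [] := fits_union xe xa fY =>
    /(_ X1x XY).
  by have := hb _ (or_introl erefl); rewrite -xa => /(_ X1x); rewrite XY xa Ya;
    case: (b).
have dis2 x : X2 x != zero -> X2 x = sopp (Y x) -> x = e.
  move=> X2x XY; apply/eqP; apply: contraT => xe.
  have [xa|xa] := eqVneq x a; last by have [_] := fits_union xe xa fY =>
    /(_ X2x XY).
  by have := hb _ (or_intror erefl); rewrite -xa => /(_ X2x); rewrite XY xa Ya;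
    case: (b).
have Ye : Y e != zero -> False.
  case Ys: (Y e) => [[]|] // _.
    have XYe : X1 e = Y e by rewrite X1e Ys.
    have Xe0 : X1 e != zero by rewrite X1e.
    have [x X1x XY] := orthogonal_disagree (orthCD CX1 DY) Xe0 XYe.
    by have := XY; rewrite (dis1 x X1x XY) X1e Ys.
  have XYe : X2 e = Y e by rewrite X2e Ys.
  have Xe0 : X2 e != zero by rewrite X2e.
  have [x X2x XY] := orthogonal_disagree (orthCD CX2 DY) Xe0 XYe.
  by have := XY; rewrite (dis2 x X2x XY) X2e Ys.
have [X1a|X1a] := eqVneq (X1 a) zero.
  have X2a : X2 a != zero by move: Xa; rewrite X1a; case: (X2 a).
  have XYa : X2 a = Y a by rewrite Ya; apply: hb => //; right.
  have [x X2x XY] := orthogonal_disagree (orthCD CX2 DY) X2a XYa.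
  by apply: Ye; rewrite -(dis2 x X2x XY) -sopp_eq0 -XY.
have XYa : X1 a = Y a by rewrite Ya; apply: hb => //; left.
have [x X1x XY] := orthogonal_disagree (orthCD CX1 DY) X1a XYa.
by apply: Ye; rewrite -(dis1 x X1x XY) -sopp_eq0 -XY.
Qed.

End Elimination.

(** * Oriented matroids from signed dual pairs *)

Section SignedPairTheory.
Variables (E : finType) (C D : {set signed_set E}).
Hypothesis CD : signed_pair C D.
Implicit Types (X Y Z : signed_set E) (P Q : {set E}).

Lemma signed_painting r b P Q :
  (exists X, [/\ X \in C, X r = Some b & circuit_fits P Q r X]) \/
  (exists Y, [/\ Y \in D, Y r = Some b & cocircuit_fits P Q r Y]).
Proof.
apply: painting => [X Y|K]; first exact: (signed_orthogonal CD).
have [[A SA /andP[rA sA]]|[A SA /andP[rA dA]]] :=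
  pair_paint (signed_supports CD) r K.
  left; have [X [CX sX Xr]] := signed_at b (signed_oppl CD) SA rA.
  by exists X; rewrite sX.
right; have [Y [DY sY Yr]] := signed_at b (signed_oppr CD) SA rA.
by exists Y; rewrite sY.
Qed.

Lemma signed_pair_incomparable X Y : X \in C -> Y \in C ->
  supp X \subset supp Y -> X = Y \/ X = signed_opp Y.
Proof.
move=> CX CY sXY; have suppC Z : Z \in C -> supp Z \in [set supp X | X in C].
  by move=> CZ; apply/imsetP; exists Z.
have sE := pair_antil (signed_supports CD) (suppC _ CX) (suppC _ CY) sXY.
apply: (signed_unique (signed_oppr CD) (dual_pairC (signed_supports CD))) => //.
- exact: suppC.
- by move=> Z DZ; rewrite orthogonalC (signed_orthogonal CD).
- by move=> Z DZ; rewrite orthogonalC (signed_orthogonal CD).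
Qed.

Lemma signed_pair_elim X Y e : X \in C -> Y \in C ->
    X <> signed_opp Y -> e \in pos_part X :&: neg_part Y ->
    exists Z, [/\ Z \in C,
      pos_part Z \subset (pos_part X :|: pos_part Y) :\ e &
      neg_part Z \subset (neg_part X :|: neg_part Y) :\ e].
Proof.
move=> CX CY XY; rewrite !inE => /andP[/eqP Xe /eqP Ye].
have [/existsP[a aXY]|/existsPn no] := boolP [exists a, X a != sopp (Y a)].
  have orthCD X' Y' (CX' : X' \in C) (DY' : Y' \in D) :=
    signed_orthogonal CD CX' DY'.
  have [|Z [CZ _ Zp Zn]] := strong_elimination orthCD _ CX CY Xe Ye aXY.
    exact: signed_painting.
  by exists Z.
by case: XY; apply/ffunP=> a; rewrite signed_oppE; apply/eqP; have := no a;
  rewrite negbK.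
Qed.

Lemma signed_pair_neq0 : signed0 E \notin C.
Proof.
apply/negP=> C0; have := pair_neq0l (signed_supports CD).
suff -> : set0 = supp (signed0 E) by rewrite imset_f.
by apply/setP=> x; rewrite !inE ffunE.
Qed.

Lemma signed_pair_om : exists M : oriented_matroid E,
  circuits M = C /\ cocircuits M = D.
Proof.
exists (OrientedMatroid signed_pair_neq0 (signed_oppl CD) signed_pair_incomparable
  signed_pair_elim).
set M := OrientedMatroid _ _ _ _; split=> //.
have VM : ucocircuits M = [set supp Y | Y in D].
  exact: (dual_pair_unique (om_dual_pair M) (signed_supports CD)).
apply/setP=> Y; rewrite inE VM; apply/andP/idP=> [[SY /forallP oY]|DY];
  last first.
  split; first by apply: imset_f.
  by apply/forallP=> X; apply/implyP=> CX; exact: (signed_orthogonal CD CX DY).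
have {}oY X : X \in C -> orthogonal X Y by move=> CX; apply: (implyP (oY X)).
have /imsetP[Y' DY' sY] := SY.
have [|->|->] := signed_unique (signed_oppl CD) (signed_supports CD) SY oY _ sY.
- by move=> X CX; exact: (signed_orthogonal CD CX DY').
- by [].
exact: (signed_oppr CD DY').
Qed.

End SignedPairTheory.

Lemma om_dual (E : finType) (M : oriented_matroid E) :
  exists N : oriented_matroid E, circuits N = cocircuits M /\ cocircuits N = circuits M.
Proof. exact: (signed_pair_om (signed_pairC (om_signed_pair M))). Qed.

Lemma ucocircuitsE (E : finType) (M : oriented_matroid E) :
  ucocircuits M = [set supp Y | Y in cocircuits M].
Proof. exact: (dual_pair_unique (om_dual_pair M) (signed_supports (om_signed_pair M))). Qed.

Lemma bases_dual (E : finType) (M N : oriented_matroid E) B :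
  circuits N = cocircuits M -> (~: B \in bases N) = (B \in bases M).
Proof.
move=> NM; rewrite !bases_pair -(basis_of_pairC (ucircuits M));
  congr basis_of_pair.
  by rewrite ucocircuitsE -NM.
apply: (dual_pair_unique (om_dual_pair N)); apply: dual_pairC.
by rewrite {2}/ucircuits NM -ucocircuitsE; apply: om_dual_pair.
Qed.

(** * Generic extensions *)

(* For S the cocircuits and B a basis, Y' is the positive signing of C*(B, e). *)
Definition consistent (E : finType) (bs : {set {set E}}) (S : {set signed_set E})
    (sg : signed_set E -> sign) : Prop :=
  forall B Y, B \in bs -> Y \in S -> sg Y = plus ->
  exists e Y', [/\ Y' \in S, supp Y' :&: B = [set e], sg Y' = plus & Y' e = Y e].

Section ExtendedSets.
Variable E : finType.
Implicit Types X Y : signed_set E.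

Definition extend X (s : sign) : signed_set (option E) :=
  [ffun o => if o is Some e then X e else s].

Lemma extendE X s o : extend X s o = if o is Some e then X e else s.
Proof. by rewrite ffunE. Qed.

Lemma restrictE (W : signed_set (option E)) e : restrict W e = W (Some e).
Proof. by rewrite ffunE. Qed.

Lemma extendK X s : restrict (extend X s) = X.
Proof. by apply/ffunP=> e; rewrite restrictE extendE. Qed.

Lemma restrictK (W : signed_set (option E)) : extend (restrict W) (W None) = W.
Proof. by apply/ffunP=> -[e|]; rewrite extendE ?restrictE. Qed.

Lemma signed_opp_extend X s : signed_opp (extend X s) = extend (signed_opp X) (sopp s).
Proof. by apply/ffunP=> -[e|]; rewrite signed_oppE !extendE ?signed_oppE. Qed.

Lemma supp_extend0 X : supp (extend X zero) = Some @: supp X.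
Proof.
apply/setP=> -[e|]; rewrite suppE extendE.
  by rewrite mem_imset ?suppE // => x y [].
by rewrite eqxx; apply/esym/imsetP=> -[].
Qed.

Lemma supp_extend X b : supp (extend X (Some b)) = None |: Some @: supp X.
Proof.
apply/setP=> -[e|]; rewrite !inE extendE //=.
by rewrite mem_imset ?suppE // => x y [].
Qed.

Lemma orthogonal_restrict (W : signed_set (option E)) X :
  orthogonal W (extend X zero) = orthogonal (restrict W) X.
Proof.
suff eqP (s : sign -> sign) : s zero = zero ->
    (exists2 o, W o != zero & W o = s (extend X zero o)) <->
    (exists2 e, restrict W e != zero & restrict W e = s (X e)).
  apply/orthogonalP/orthogonalP; have := eqP id erefl; have := eqP sopp erefl;
    tauto.
move=> s0; split=> [[[e|]]|[e]]; rewrite ?restrictE ?extendE.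
- by exists e; rewrite restrictE.
- by rewrite s0 => /eqP.
by exists (Some e); rewrite ?extendE.
Qed.

End ExtendedSets.

(** * Signs of fundamental cocircuits *)

Section FundamentalDirection.
Variables (E : finType) (M : oriented_matroid E) (sg : signed_set E -> sign).
Hypothesis Hsg : generic_cocircuit_signature M sg.
Implicit Types (B : {set E}) (X Y : signed_set E).

Lemma supp_cocircuit Y : Y \in cocircuits M -> supp Y \in ucocircuits M.
Proof. by rewrite inE => /andP[]. Qed.

Lemma cocircuits_opp Y : Y \in cocircuits M -> signed_opp Y \in cocircuits M.
Proof. exact: (signed_oppr (om_signed_pair M)). Qed.

Lemma om_orthogonal X Y : X \in circuits M -> Y \in cocircuits M ->
  orthogonal X Y.
Proof. exact: (signed_orthogonal (om_signed_pair M)). Qed.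

Lemma cocircuit_signed D b : D \in ucocircuits M ->
  exists Y, [/\ Y \in cocircuits M, supp Y = D & sg Y = Some b].
Proof.
rewrite ucocircuitsE => /imsetP[Y MY ->]; have [sgN sg0] := Hsg.
case sgY: (sg Y) (sg0 _ MY) => [c|] // _.
have [<-|cb] := eqVneq c b; first by exists Y.
exists (signed_opp Y); rewrite cocircuits_opp // supp_opp sgN // sgY; split=>
  //.
by case: c b cb {sgY} => [] [].
Qed.

Lemma basis_cocircuit B e b : B \in bases M -> e \in B ->
  exists Y, [/\ Y \in cocircuits M, supp Y :&: B = [set e] & sg Y = Some b].
Proof.
rewrite bases_pair -basis_of_pairC => bB eB.
have VU := dual_pairC (om_dual_pair M);
  have enB : e \notin ~: B by rewrite inE negbK.
have [D VD /andP[eD sD]] := basis_circuit VU bB enB.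
have [Y [MY sY sgY]] := cocircuit_signed b VD.
exists Y; rewrite sY; split=> //.
by have := basis_circuit_trace bB VD sD enB; rewrite setDE setCK.
Qed.

Lemma basis_cocircuit_unique B e Y Y' : B \in bases M -> e \in B ->
  Y \in cocircuits M -> Y' \in cocircuits M ->
  supp Y :&: B = [set e] -> supp Y' :&: B = [set e] -> supp Y = supp Y'.
Proof.
rewrite bases_pair -basis_of_pairC => bB eB MY MY' tY tY'.
have VU := dual_pairC (om_dual_pair M);
  have enB : e \notin ~: B by rewrite inE negbK.
have sub Z : supp Z :&: B = [set e] -> supp Z \subset e |: ~: B.
  move=> /setP tZ; apply/subsetP=> x xZ; have := tZ x;
    rewrite in_setI xZ !inE /=.
  by move=> ->; case: eqP.
by apply: (basis_circuit_unique VU bB _ _ (sub _ tY) (sub _ tY') enB);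
  apply: supp_cocircuit.
Qed.

(** The part of beta(B) on B, continued by zero outside B. *)
Definition direction B e : sign :=
  if [pick Y in cocircuits M | (supp Y :&: B == [set e]) && (sg Y == plus)]
  is Some Y then Y e else zero.

Lemma directionE B e Y : B \in bases M -> Y \in cocircuits M ->
  supp Y :&: B = [set e] -> sg Y = plus -> direction B e = Y e.
Proof.
move=> bB MY tY sgY; rewrite /direction.
case: pickP => [Y' /and3P[MY' /eqP tY' /eqP sgY']|/(_ Y)]; last first.
  by rewrite MY tY sgY !eqxx.
have eB : e \in B by have /setP/(_ e) := tY; rewrite in_setI in_set1 eqxx =>
  /andP[].
have sYY' := basis_cocircuit_unique bB eB MY MY' tY tY'.
have sub : supp Y \subset supp Y' by rewrite sYY'.
have [->//|YY'] := signed_pair_incomparable (signed_pairC (om_signed_pair M)) MY MY' sub.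
by have [sgN _] := Hsg; move: sgY; rewrite YY' sgN ?sgY'.
Qed.

Lemma direction_neq0 B e : B \in bases M -> (direction B e != zero) = (e \in B).
Proof.
move=> bB; apply/idP/idP=> [|eB].
  rewrite /direction; case: pickP => // Y /and3P[_ /eqP/setP/(_ e) + _] _.
  by rewrite in_setI in_set1 eqxx => /andP[].
have [Y [MY tY sgY]] := basis_cocircuit true bB eB.
rewrite (directionE bB MY tY sgY) -suppE.
by have /setP/(_ e) := tY; rewrite in_setI in_set1 eqxx => /andP[].
Qed.

Lemma consistent_direction B Y c : consistent (bases M) (cocircuits M) sg ->
  B \in bases M -> Y \in cocircuits M -> sg Y = Some c ->
  exists2 e, e \in B & direction B e = smul c (Y e).
Proof.
move=> cons bB MY sgY; pose Y1 := if c then Y else signed_opp Y.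
have MY1 : Y1 \in cocircuits M by rewrite /Y1; case: (c);
  rewrite ?cocircuits_opp.
have sgY1 : sg Y1 = plus.
  by have [sgN _] := Hsg; rewrite /Y1; case: (c) sgY; rewrite ?sgN // => ->.
have [e [Y' [MY' tY' sgY' Y'e]]] := cons B Y1 bB MY1 sgY1.
exists e; first by have /setP/(_ e) := tY'; rewrite in_setI in_set1 eqxx =>
  /andP[].
by rewrite (directionE bB MY' tY' sgY') Y'e /Y1; case: (c);
  rewrite ?signed_oppE.
Qed.

End FundamentalDirection.

Section Deletion.
Variables (E : finType) (M : oriented_matroid E) (N : oriented_matroid (option E)).
Hypothesis delN : deletion_circuits N = circuits M.

Lemma deletion_extend X : X \in circuits M -> extend X zero \in circuits N.
Proof.
rewrite -delN => /imsetP[W]; rewrite inE => /andP[NW /eqP W0] ->.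
by rewrite -W0 restrictK.
Qed.

(** Circuits of M are circuits of N, so none of them meets the old part of D in a single element,
    and [cocircuit_in] applies. *)
Lemma deletion_cocircuit D e : D \in ucocircuits N -> Some e \in D ->
  exists2 D', D' \in ucocircuits M & (e \in D') && (Some @: D' \subset D).
Proof.
move=> VD eD; have [||D' VD' /andP[eD' sD']] :=
  cocircuit_in (om_dual_pair M) (A := [set x | Some x \in D]) (e := e).
- by rewrite inE.
- move=> C /mem_ucircuits[X MX <-] eX.
  have UX := supp_circuit (deletion_extend MX).
  have eX' : Some e \in supp (extend X zero) by rewrite supp_extend0 imset_f.
  have [[x|] xe] := pair_meet (om_dual_pair N) UX VD eX' eD;
    rewrite supp_extend0.
    rewrite mem_imset; last by move=> ? ? [].
    move=> /andP[xX xD]; exists x; first by apply: contraNneq xe => ->.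
    by rewrite xX inE.
  by move=> /andP[/imsetP[]].
exists D' => //; rewrite eD'; apply/subsetP=> _ /imsetP[x /(subsetP sD') + ->].
by rewrite inE.
Qed.

End Deletion.

Section GenericExtension.
Variables (E : finType) (M : oriented_matroid E) (sg : signed_set E -> sign).
Hypothesis Hsg : generic_cocircuit_signature M sg.
Hypothesis cons : consistent (bases M) (cocircuits M) sg.
Implicit Types (B : {set E}) (X Y : signed_set E) (W Z : signed_set (option E)).

Local Notation dir := (direction M sg).
Local Notation extended Y := (extend Y (sg Y)).

(** The set [C_B] of the overview if [b] is true, its opposite otherwise. The signs are forced: the
    extended positive cocircuit of [e] in B meets it in [e] and the new element only. *)
Definition new_circuit (b : bool) B : signed_set (option E) :=
  extend [ffun e => smul (~~ b) (dir B e)] (Some b).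

Definition extension_circuits : {set signed_set (option E)} :=
  [set extend X zero | X in circuits M] :|:
  [set new_circuit p.1 p.2 | p in setX [set: bool] (bases M)].
Local Notation C' := extension_circuits.

Lemma new_circuitE b B e : new_circuit b B (Some e) = smul (~~ b) (dir B e).
Proof. by rewrite extendE ffunE. Qed.

Lemma smul_eq0 b s : (smul b s == zero) = (s == zero).
Proof. by case: b s => [] [[]|]. Qed.

Lemma supp_new_circuit b B : B \in bases M ->
  supp (new_circuit b B) = None |: Some @: B.
Proof.
move=> bB; rewrite supp_extend (_ : supp _ = B) //; apply/setP=> e.
by rewrite suppE ffunE smul_eq0 direction_neq0.
Qed.

Lemma new_circuit_opp b B : signed_opp (new_circuit b B) = new_circuit (~~ b) B.
Proof.
apply/ffunP=> -[e|]; rewrite signed_oppE ?new_circuitE;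
  last by rewrite !extendE.
by case: b (dir B e) => [] [[]|].
Qed.

Lemma extension_circuitsP W :
  reflect ((exists2 X, X \in circuits M & W = extend X zero) \/
           exists b B, B \in bases M /\ W = new_circuit b B) (W \in C').
Proof.
apply: (iffP setUP) => -[]; try by move=> /imsetP[X MX ->]; left; exists X.
- by move=> /imsetP[[b B] /setXP[_ bB] ->]; right; exists b, B.
- by move=> [X MX ->]; left; apply/imsetP; exists X.
by move=> [b [B [bB ->]]]; right; apply/imsetP; exists (b, B) => //;
  rewrite in_setX in_setT.
Qed.

Lemma new_circuit_in b B : B \in bases M -> new_circuit b B \in C'.
Proof. by move=> bB; apply/extension_circuitsP; right; exists b, B. Qed.

Lemma old_circuit_in X : X \in circuits M -> extend X zero \in C'.
Proof. by move=> MX; apply/extension_circuitsP; left; exists X. Qed.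

(** For a new circuit, consistency provides an [e] in B at which W and Y agree exactly when they
    disagree at the new element; these two elements suffice. *)
Lemma extension_orthogonal W Y : W \in C' -> Y \in cocircuits M ->
  orthogonal W (extended Y).
Proof.
move=> /extension_circuitsP[[X MX ->]|[b [B [bB ->]]]] MY.
  rewrite orthogonalC orthogonal_restrict extendK orthogonalC.
  exact: om_orthogonal MX MY.
have [sgN sg0] := Hsg; case sgY: (sg Y) (sg0 _ MY) => [c|] // _.
have [e eB dirY] := consistent_direction Hsg cons bB MY sgY.
have W0 : new_circuit b B (Some e) != zero.
  by rewrite new_circuitE smul_eq0 direction_neq0.
apply/orthogonalP; split=> _; have [bc|bc] := eqVneq b c.
- by exists (Some e) => //; rewrite new_circuitE extendE dirY bc;
  case: (c) (Y e) => [] [[]|].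
- by exists None; rewrite !extendE //; case: b c bc {sgY dirY W0} => [] [].
- by exists None; rewrite !extendE ?bc.
exists (Some e) => //; rewrite new_circuitE extendE dirY.
by case: b c bc (Y e) {sgY dirY W0} => [] [] // _ [[]|].
Qed.

Lemma extension_circuits_opp W : W \in C' -> signed_opp W \in C'.
Proof.
move=> /extension_circuitsP[[X MX ->]|[b [B [bB ->]]]].
  by rewrite signed_opp_extend old_circuit_in ?circuits_opp.
by rewrite new_circuit_opp new_circuit_in.
Qed.

Lemma extension_circuits_neq0 : signed0 (option E) \notin C'.
Proof.
apply/extension_circuitsP=> -[[X MX]|[b [B [bB]]]] /ffunP eq0.
  have := circuits_neq0 M; suff <- : X = signed0 E by rewrite MX.
  by apply/ffunP=> e; have := eq0 (Some e); rewrite extendE !ffunE.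
by have := eq0 None; rewrite extendE ffunE.
Qed.

Lemma basis_incomparable B B' : B \in bases M -> B' \in bases M ->
  B \subset B' -> B = B'.
Proof. by rewrite !bases_pair; apply: basis_subset (om_dual_pair M) _ _. Qed.

Lemma Some_subset (A A' : {set E}) :
  (Some @: A \subset None |: Some @: A') = (A \subset A').
Proof.
have injS : injective (@Some E) by move=> x y [].
apply/subsetP/subsetP=> sA x.
  by move=> xA; have := sA (Some x); rewrite !inE !mem_imset //; apply.
by case/imsetP=> y /sA yA' ->; rewrite !inE mem_imset.
Qed.

Lemma extension_circuits_incomparable W W' : W \in C' -> W' \in C' ->
  supp W \subset supp W' -> W = W' \/ W = signed_opp W'.
Proof.
move=> /extension_circuitsP[[X MX ->]|[b [B [bB ->]]]]
  /extension_circuitsP[[X' MX' ->]|[b' [B' [bB' ->]]]].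
- rewrite !supp_extend0 => sX; have {}sX : supp X \subset supp X'.
    by rewrite -Some_subset; apply: subset_trans sX (subsetUr _ _).
  have [->|->] := circuits_incomparable MX MX' sX; first by left.
  by right; rewrite signed_opp_extend.
- rewrite supp_extend0 supp_new_circuit // Some_subset => sX.
  by have /basesP[/indepP/(_ _ (supp_circuit MX))] := bB'; rewrite sX.
- move=> /subsetP/(_ None); rewrite supp_new_circuit // supp_extend0 !inE eqxx.
  by move=> /(_ isT)/imsetP[].
rewrite !supp_new_circuit // subUset Some_subset =>
  /andP[_] /(basis_incomparable bB bB') <-.
rewrite new_circuit_opp; have [->|bb'] := eqVneq b b'; first by left.
by right; congr new_circuit; case: b b' bb' => [] [].
Qed.

(** Without signs: the old part of K either contains a basis, which gives a new circuit, or misses a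
    cocircuit, whose signing with [sg] equal to [b] is extended. *)
Lemma extension_painting b P Q :
  (exists W, [/\ W \in C', W None = Some b & circuit_fits P Q None W]) \/
  (exists Z, [/\ Z \in [set extended Y | Y in cocircuits M], Z None = Some b &
     cocircuit_fits P Q None Z]).
Proof.
apply: painting => [W _ CW /imsetP[Y MY ->]|K];
  first exact: extension_orthogonal.
pose K0 := [set e | Some e \in K].
have [/forall_inP hK0|/forall_inPn[D VD]] :=
    boolP [forall D in ucocircuits M, [exists e in D, e \in K0]].
  have [|||B [bB _ sB]] := basis_extend (om_dual_pair M) (I := set0) (S := K0).
  - by move=> C UC; rewrite subset0; apply: contraTneq UC => ->;
    apply: ucircuits_neq0.
  - by move=> D /hK0/exists_inP.
  - exact: sub0set.
  rewrite -bases_pair in bB; left; exists (new_circuit b B).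
  rewrite new_circuit_in // supp_new_circuit // extendE; split=> //;
    apply: setUS.
  by apply/subsetP=> _ /imsetP[e /(subsetP sB) + ->]; rewrite inE.
move=> /exists_inPn hD; right; have [Y [MY sY sgY]] :=
  cocircuit_signed Hsg b VD.
exists (extended Y); split; first exact: imset_f.
  by rewrite extendE.
rewrite sgY supp_extend; apply/pred0P=> -[e|] /=; rewrite !inE //=.
rewrite mem_imset; last by move=> ? ? [].
by apply/negP=> /andP[]; rewrite sY => /hD; rewrite inE => /negPf ->.
Qed.

(** Unless the values at the new element are opposite or both zero, strong elimination rooted there
    applies; two zeros reduce to elimination in M. In the remaining case both circuits are new, and
    painting in M, rooted at an old element, either eliminates directly or yields a cocircuit to be
    refuted. *)
Lemma extension_circuits_elim W1 W2 o : W1 \in C' -> W2 \in C' ->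
  W1 <> signed_opp W2 -> o \in pos_part W1 :&: neg_part W2 ->
  exists Z, [/\ Z \in C',
      pos_part Z \subset (pos_part W1 :|: pos_part W2) :\ o &
      neg_part Z \subset (neg_part W1 :|: neg_part W2) :\ o].
Proof.
move=> CW1 CW2 W12; rewrite !inE => /andP[/eqP W1o /eqP W2o].
have [None12|None12] := boolP (W1 None != sopp (W2 None)).
  have orthC' W Z : W \in C' -> Z \in [set extended Y | Y in cocircuits M] ->
    orthogonal W Z.
    by move=> CW /imsetP[Y' MY' ->]; apply: extension_orthogonal.
  have [|Z [CZ _ Zp Zn]] := strong_elimination orthC' _ CW1 CW2 W1o W2o None12.
    exact: extension_painting.
  by exists Z.
move: None12; rewrite negbK => /eqP None12.
have [[X1 MX1 W1E]|[s [B1 [bB1 W1E]]]] := extension_circuitsP _ CW1;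
  have [[X2 MX2 W2E]|[s' [B2 [bB2 W2E]]]] := extension_circuitsP _ CW2;
  move: None12; rewrite W1E W2E !extendE //.
  case: o W1o W2o => [e|]; rewrite W1E W2E !extendE // => X1e X2e _.
  have [||Z [MZ Zp Zn]] := circuits_elim MX1 MX2 (e := e).
  - by move=> X12; case: W12; rewrite W1E W2E X12 signed_opp_extend.
  - by rewrite !inE X1e X2e.
  exists (extend Z zero); rewrite old_circuit_in //; split=> //.
    apply/subsetP=> -[x|]; rewrite !inE !extendE // => Zx.
    by have := subsetP Zp x; rewrite !inE; apply.
  apply/subsetP=> -[x|]; rewrite !inE !extendE // => Zx.
  by have := subsetP Zn x; rewrite !inE; apply.
move=> [ss']; rewrite -W1E -W2E.
have W1N : W1 None = Some s by rewrite W1E extendE.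
have W2N : W2 None = Some (~~ s) by rewrite W2E extendE ss' negbK.
pose P := pos_union W1 W2 o; pose Q := neg_union W1 W2 o.
pose admissible Y := cocircuit_fits P Q None (extended Y).
(* Y and W agree at the new element, so they disagree somewhere, and an
   admissible Y can disagree with W1 or W2 only at the eliminated element. *)
have key W Y : W = W1 \/ W = W2 -> Y \in cocircuits M -> admissible Y ->
    W None = sg Y -> exists2 x, Some x = o & W o = sopp (Y x).
  move=> WW MY aY WY; have CW : W \in C' by case: WW => ->.
  have WN : W None != zero by case: WW => ->; rewrite ?W1N ?W2N.
  have [|p Wp WpY] := orthogonal_disagree (extension_orthogonal CW MY) WN.
    by rewrite extendE.
  have [po|po] := eqVneq p o.
    case: p po Wp WpY => [x|] po Wp; rewrite extendE => WpY; first by exists x;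
      rewrite -?po.
    by move: WN WY; rewrite {1}WpY; case: (sg Y) WpY => [[]|] // ->.
  have [pN|pN] := eqVneq p None.
    by move: WN WY; rewrite pN extendE in WpY; rewrite WpY; case: (sg Y) =>
      [[]|].
  by have [h1 h2] := fits_union po pN aY; case: WW => WE; rewrite WE in Wp WpY;
    [case: (h1 Wp WpY)|case: (h2 Wp WpY)].
have none Y : Y \in cocircuits M -> admissible Y ->
    (forall x, Some x = o -> Y x = zero) -> False.
  move=> MY aY Yo; have [_ /(_ _ MY)] := Hsg; case sgY: (sg Y) => [c|] // _.
  have [cs|cs] := eqVneq c s.
    have [||x xo] := key W1 Y _ MY aY; [by left|by rewrite W1N sgY cs|].
    by rewrite W1o (Yo x xo).
  have [||x xo] := key W2 Y _ MY aY; [by right| |by rewrite W2o (Yo x xo)].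
  by rewrite W2N sgY; case: (c) (s) cs => [] [].
have admissibleP Y : (forall x, (Y x = plus -> Some x \notin Q) /\
    (Y x = minus -> Some x \notin P)) -> admissible Y.
  by move=> aY [x|] // _; rewrite extendE.
have admissibleE Y x : admissible Y -> (Y x = plus -> Some x \notin Q) /\
    (Y x = minus -> Some x \notin P).
  by move=> aY; have := aY (Some x) isT; rewrite extendE.
(* W2 vanishes at [a], so the sign of W1 is the only one that the unions P and Q allow there. *)
have [a aB1 aB2] : exists2 a, a \in B1 & a \notin B2.
  apply/subsetPn/negP=> /(basis_incomparable bB1 bB2) B12; case: W12.
  by rewrite W1E W2E new_circuit_opp B12 ss'.
have W1a : W1 (Some a) != zero by rewrite W1E new_circuitE smul_eq0 direction_neq0.
have W2a : W2 (Some a) = zero.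
  by apply/eqP; rewrite W2E new_circuitE smul_eq0; apply: contraNT aB2;
    rewrite direction_neq0.
have ao : Some a != o by apply: contraTneq isT => ao; rewrite ao W2o in W2a.
case W1ab: (W1 (Some a)) W1a => [b|] // _.
have aP : (Some a \in P) = b by rewrite !inE ao W1ab W2a orbF; case: (b).
have aQ : (Some a \in Q) = ~~ b by rewrite !inE ao W1ab W2a orbF; case: (b).
have [[X [MX Xa fX]]|[Y [MY Ya fY]]] := signed_painting (om_signed_pair M) a b
    [set x | Some x \in P] [set x | Some x \in Q].
  exists (extend X zero); rewrite old_circuit_in //; split=> //.
    apply/subsetP=> -[x|]; rewrite inE extendE // => /eqP Xx.
    have [xa|xa] := eqVneq x a; last by have [/(_ Xx)] := fX x xa; rewrite inE.
    by rewrite -/P xa aP; move: Xa; rewrite -xa Xx => -[<-].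
  apply/subsetP=> -[x|]; rewrite inE extendE // => /eqP Xx.
  have [xa|xa] := eqVneq x a; last by have [_ /(_ Xx)] := fX x xa; rewrite inE.
  by rewrite -/Q xa aQ; move: Xa; rewrite -xa Xx => -[<-].
have aY : admissible Y.
  apply: admissibleP => x; have [->|xa] := eqVneq x a.
    by rewrite Ya aP aQ; case: (b).
  by have := fY x xa; rewrite !inE.
case: o W1o W2o @P @Q @admissible key none admissibleP admissibleE ao aP aQ fY aY
  => [e|] W1o W2o P Q admissible key none admissibleP admissibleE ao aP aQ fY aY;
  last by case: (none Y MY aY).
have NP : None \in P by rewrite !inE W1N W2N; case: (s).
have NQ : None \in Q by rewrite !inE W1N W2N; case: (s).
(* The new element may take both signs, so painting rooted there either eliminates or gives
   admissible cocircuits with either value of [sg]; [key] then fixes their signs at [e]. *)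
have paint c : (exists Z, [/\ Z \in C', pos_part Z \subset P & neg_part Z \subset Q]) \/
    exists Y, [/\ Y \in cocircuits M, sg Y = Some c & admissible Y].
  have [[Z [CZ ZN fZ]]|[_ [/imsetP[Y' MY' ->]]]] := extension_painting c P Q.
    left; exists Z; split=> //; apply/subsetP=> p; rewrite inE => /eqP Zp.
      have [->//|pN] := eqVneq p None; by have [/(_ Zp)] := fZ p pN.
    have [->//|pN] := eqVneq p None; by have [_ /(_ Zp)] := fZ p pN.
  by rewrite extendE => sgY' aY'; right; exists Y'.
have [//|[Y1 [MY1 sgY1 aY1]]] := paint s.
have [//|[Y2 [MY2 sgY2 aY2]]] := paint (~~ s).
have Y1e : Y1 e = minus.
  have [||x [->]] := key W1 Y1 _ MY1 aY1; [by left|by rewrite W1N sgY1|].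
  by rewrite W1o; case: (Y1 e) => [[]|].
have Y2e : Y2 e = plus.
  have [||x [->]] := key W2 Y2 _ MY2 aY2; [by right|by rewrite W2N sgY2|].
  by rewrite W2o; case: (Y2 e) => [[]|].
exfalso.
(* Eliminating [e] preserves admissibility and leaves zero at [e], which [none] forbids. The two are
   not opposite: one has sign [b] at [a], and the other sign is not admissible there. *)
have elim Y3 Y4 : Y3 \in cocircuits M -> Y4 \in cocircuits M -> admissible Y3 ->
    admissible Y4 -> Y3 e = plus -> Y4 e = minus ->
      Y3 a = Some b \/ Y4 a = Some b -> False.
  move=> MY3 MY4 aY3 aY4 Y3e Y4e Yb.
  have [||Y5 [MY5 Yp Yn]] :=
      signed_pair_elim (signed_pairC (om_signed_pair M)) MY3 MY4 (e := e).
  - move=> Y34; have [h1 h2] := admissibleE _ a aY3; have [h3 h4] :=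
    admissibleE _ a aY4.
    move: h1 h2 h3 h4 Yb; rewrite Y34 signed_oppE aP aQ.
    by case: (Y4 a) (b) => [[]|] [] h1 h2 h3 h4 [] // _;
      first [by have := h1 erefl|by have := h2 erefl|by have :=
        h3 erefl|by have := h4 erefl].
  - by rewrite !inE Y3e Y4e.
  apply: (none Y5 MY5); last first.
    move=> x [->]; have := subsetP Yp e; have := subsetP Yn e;
      rewrite !inE eqxx /=.
    by case: (Y5 e) => [[]|] // h1 h2; [have := h2 isT|have := h1 isT].
  apply: admissibleP => x; have [h1 h2] := admissibleE _ x aY3; have [h3 h4] :=
    admissibleE _ x aY4.
  have Y5p : Y5 x = plus -> Y3 x = plus \/ Y4 x = plus.
    move=> Y5x; have := subsetP Yp x; rewrite !inE Y5x => /(_ isT)/andP[_].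
    by move=> /orP[]/eqP; [left|right].
  have Y5n : Y5 x = minus -> Y3 x = minus \/ Y4 x = minus.
    move=> Y5x; have := subsetP Yn x; rewrite !inE Y5x => /(_ isT)/andP[_].
    by move=> /orP[]/eqP; [left|right].
  by split=> [/Y5p|/Y5n] [].
case Ye: (Y e) => [[]|].
- by apply: (elim Y Y1) => //; left.
- by apply: (elim Y2 Y) => //; right.
by apply: (none Y MY aY) => x [->].
Qed.

Lemma extension_exists : exists N : oriented_matroid (option E),
  is_generic_extension M N /\ induced_by_extension M sg N.
Proof.
pose N := OrientedMatroid extension_circuits_neq0 extension_circuits_opp
  extension_circuits_incomparable extension_circuits_elim.
have injS : injective (@Some E) by move=> x y [].
have NE : circuits N = C' by [].
have delN : deletion_circuits N = circuits M.
  apply/setP=> X; apply/imsetP/idP=> [[W]|MX]; last first.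
    by exists (extend X zero);
      rewrite ?extendK // inE NE old_circuit_in // extendE.
  rewrite inE => /andP[/extension_circuitsP[[X' MX' ->]|[b [B [_ ->]]]]].
    by rewrite extendK => _ ->.
  by rewrite extendE.
have basesN B : B \in bases M -> Some @: B \in bases N.
  move=> bB; apply/basesP; split=> [|o].
    apply/indepP=> _ /mem_ucircuits[W /extension_circuitsP CW <-]; apply/negP.
    case: CW => [[X MX ->]|[b [B' [bB' ->]]]]; last first.
      by rewrite supp_new_circuit // subUset sub1set => /andP[/imsetP[]].
    rewrite supp_extend0 => sX.
    have /basesP[/indepP/(_ _ (supp_circuit MX)) + _] := bB; case/negP.
    by rewrite -Some_subset; apply: subset_trans sX (subsetUr _ _).
  apply/spansP; case: o => [e|]; last first.
    right; exists (supp (new_circuit true B)); last first.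
      by rewrite supp_new_circuit // !inE eqxx /=.
    by apply: supp_circuit; apply: new_circuit_in.
  have /basesP[_ /(_ e)/spansP[eB|[C UC /andP[eC sC]]]] := bB.
    by left; rewrite mem_imset.
  right; have [X MX XC] := mem_ucircuits _ _ UC; exists (Some @: C).
    by rewrite -XC -supp_extend0; apply/supp_circuit/old_circuit_in.
  rewrite mem_imset // eC /=; apply/subsetP=> _ /imsetP[x /(subsetP sC) + ->].
  by rewrite !in_setU !in_set1 mem_imset.
have [B0 bB0] := pair_ex_basis (om_dual_pair M); rewrite -bases_pair in bB0.
have genN C : C \in ucircuits N -> None \in C -> spanning N C.
  move=> /mem_ucircuits[W /extension_circuitsP CW <-].
  case: CW => [[X MX ->]|[b [B [bB ->]]]] NC; first by move: NC;
    rewrite inE extendE.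
  apply/existsP; exists (Some @: B); rewrite basesN // supp_new_circuit //.
  exact: subsetUr.
have cocN Y : Y \in cocircuits M -> extended Y \in cocircuits N.
  move=> MY; rewrite inE; apply/andP; split; last first.
    by apply/forallP=> W; apply/implyP=> CW; apply: extension_orthogonal.
  have [_ /(_ _ MY)] := Hsg; case sgY: (sg Y) => [c|] // _.
  have NY : None \in supp (extend Y (Some c)) by rewrite inE extendE.
  have [|D VD /andP[ND sD]] := cocircuit_in (om_dual_pair N) NY.
    move=> _ /mem_ucircuits[W CW <-]; rewrite suppE => WN.
    have oWY := extension_orthogonal CW MY; rewrite sgY in oWY.
    have [WY|WY] := eqVneq (W None) (Some c).
      have [|x Wx WxY] := orthogonal_disagree oWY WN; first by rewrite extendE.
      exists x; last by rewrite !suppE Wx -sopp_eq0 -WxY.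
      by apply: contraNneq Wx => xN; move: WxY; rewrite xN extendE WY;
        case: (c).
    have [|x Wx WxY] := orthogonal_agree oWY WN.
      by rewrite extendE; apply: sopp_neq => //; apply/eqP.
    exists x; last by rewrite !suppE Wx -WxY.
    by apply: contraNneq WY => xN; rewrite -xN WxY xN extendE.
  suff -> : supp (extend Y (Some c)) = D by [].
  (* A new circuit meets D in a second, hence old, element. So D contains a cocircuit of M inside
     [supp Y], that is, all of [supp Y]. *)
  have Nn : None \in supp (new_circuit true B0) by rewrite supp_new_circuit // !inE.
  have UN : supp (new_circuit true B0) \in ucircuits N.
    by apply: supp_circuit; apply: new_circuit_in.
  have [[e|] // _ /andP[_ eD]] := pair_meet (om_dual_pair N) UN VD Nn ND.
  have [D' VD' /andP[_ sD']] := deletion_cocircuit delN VD eD.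
  have sDY : D' \subset supp Y.
    by rewrite -Some_subset -(supp_extend _ c); apply: subset_trans sD' sD.
  have YD' := pair_antir (om_dual_pair M) VD' (supp_cocircuit MY) sDY.
  apply/eqP; rewrite eqEsubset sD andbT supp_extend subUset sub1set ND /=.
  by rewrite -YD'.
exists N; split; first split=> //.
  by split=> //; rewrite (rank_basis bB0) (rank_basis (basesN _ bB0)) card_imset.
move=> Y MY; rewrite /extension_signature.
case: pickP => [W /andP[NW /eqP WY]|/(_ (extended Y))]; last first.
  by rewrite extendK eqxx cocN.
have [_ /(_ _ MY)] := Hsg; case sgY: (sg Y) => [c|] // _.
have NY := cocN Y MY; rewrite sgY in NY.
have sW : supp W \subset supp (extend Y (Some c)).
  by apply/subsetP=> -[x|]; rewrite !suppE extendE // -WY restrictE.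
have [->|WY'] := signed_pair_incomparable (signed_pairC (om_signed_pair N)) NW NY sW.
  by rewrite extendE.
have [Y0|[x]] := set_0Vmem (supp Y).
  by have := pair_neq0r (om_dual_pair M); rewrite -Y0 supp_cocircuit.
rewrite suppE -{1}WY WY' restrictE signed_oppE extendE => Yx.
have := congr1 (fun f : signed_set E => f x) WY;
  rewrite WY' /= restrictE signed_oppE extendE.
by case: (Y x) Yx => [[]|].
Qed.

End GenericExtension.

(** * Liftings, induced signatures and lexicographic signatures *)

Section Lifting.
Variables (E : finType) (M : oriented_matroid E) (sg : signed_set E -> sign).
Hypothesis Hsg : generic_circuit_signature M sg.

Lemma basis_circuit_signed B e b : B \in bases M -> e \notin B ->
  exists X, [/\ X \in circuits M, supp X :&: ~: B = [set e] & sg X = Some b].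
Proof.
have [Md [dM Md']] := om_dual M => bB eB.
have HsgD : generic_cocircuit_signature Md sg by rewrite /generic_cocircuit_signature Md'.
have bBd : ~: B \in bases Md by rewrite (bases_dual _ dM).
by rewrite -Md'; apply: (basis_cocircuit HsgD b bBd); rewrite in_setC.
Qed.

(** Extend the dual and dualise back. It remains to see that the minimal nonzero restrictions of
    circuits of N are the circuits of M: by [deletion_cocircuit] every nonzero restriction contains
    the support of one. *)
Lemma lifting_exists :
  consistent [set ~: B | B in bases M] (circuits M) sg ->
  exists N : oriented_matroid (option E), is_lifting M N /\ induced_by_lifting M sg N.
Proof.
have [Md [dM Md']] := om_dual M => cons.
have HsgD : generic_cocircuit_signature Md sg by rewrite /generic_cocircuit_signature Md'.
have consD : consistent (bases Md) (cocircuits Md) sg.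
  rewrite Md' => B Y bB; apply: cons; apply/imsetP; exists (~: B);
    last by rewrite setCK.
  by rewrite -(bases_dual _ dM) setCK.
have [N' [[[rkN' delN'] _] indN']] := extension_exists HsgD consD.
have [N [dN dN']] := om_dual N'.
have indN : induced_by_lifting M sg N.
  by move=> X MX; rewrite /lifting_signature dN; apply: indN'; rewrite Md'.
exists N; split=> //; split.
  have [B bB] := pair_ex_basis (om_dual_pair M); rewrite -bases_pair in bB.
  have [B' bB'] := pair_ex_basis (om_dual_pair N'); rewrite -bases_pair in bB'.
  have bBd : ~: B \in bases Md by rewrite (bases_dual _ dM).
  have bB'd : ~: B' \in bases N by rewrite (bases_dual _ dN).
  rewrite (rank_basis bB) (rank_basis bB'd); move: rkN'.
  rewrite (rank_basis bB') (rank_basis bBd) => eqB.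
  have := cardsC B'; rewrite eqB card_option -(cardsC B) => /eqP.
  by rewrite -addSn addnC eqn_add2r => /eqP.
have extN X : X \in circuits M -> exists2 W, W \in circuits N & restrict W = X.
  move=> MX; have [_ /(_ _ MX)] := Hsg; rewrite (indN X MX) /lifting_signature.
  by case: pickP => // W /andP[NW /eqP WX] _; exists W.
have X0 X : X \in circuits M -> X != signed0 E.
  by move=> MX; apply: contraTneq MX => ->; apply: circuits_neq0.
have below W : W \in circuits N -> restrict W != signed0 E ->
    exists2 X, X \in circuits M & supp X \subset supp (restrict W).
  rewrite dN => N'W W0; have [S0|[e]] := set_0Vmem (supp (restrict W)).
    by rewrite (supp_eq0 S0) eqxx in W0.
  rewrite suppE restrictE -suppE => eW.
  have [D] := deletion_cocircuit delN' (supp_cocircuit N'W) eW.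
  rewrite ucocircuitsE Md' => /imsetP[X MX ->] /andP[_ sX]; exists X => //.
  by apply/subsetP=> x xX;
    rewrite suppE restrictE -suppE (subsetP sX) // imset_f.
apply/setP=> X; rewrite inE; apply/andP/idP=> [[]|MX].
  rewrite !inE => /andP[nX0 /imsetP[W NW XW]] /forall_inP minX.
  have [|X1 MX1 sX1] := below W NW; first by rewrite -XW.
  have [W1 NW1 W1X] := extN _ MX1; rewrite -XW in sX1.
  have /minX : X1 \in [set restrict X | X in circuits N] :\ signed0 E.
    by rewrite !inE X0 // -W1X imset_f.
  rewrite properE sX1 negbK /= => sW.
  have sE : supp X1 = supp X by apply/eqP; rewrite eqEsubset sX1.
  (* X and the circuit X1 have the same support and are orthogonal to all cocircuits of M, hence
     equal up to sign. *)
  have orthX Y : Y \in circuits Md -> orthogonal Y X.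
    move=> MY; rewrite orthogonalC XW -orthogonal_restrict orthogonalC.
    by apply: om_orthogonal (deletion_extend delN' MY) _; rewrite -dN.
  have orthX1 Y : Y \in circuits Md -> orthogonal Y X1.
    by move=> MY; apply: om_orthogonal MY _; rewrite Md'.
  have pairMd := om_signed_pair Md; rewrite Md' in pairMd.
  have SX1 : supp X1 \in [set supp X | X in circuits M] by apply: imset_f.
  have [<- //|X1E] := signed_unique (signed_oppl pairMd) (signed_supports pairMd) SX1 orthX1 orthX sE.
  by rewrite -(signed_oppK X) -X1E; apply: circuits_opp.
split; first by rewrite !inE X0 //; have [W NW <-] := extN X MX;
  rewrite imset_f.
apply/forall_inP=> Y; rewrite !inE => /andP[Y0 /imsetP[W NW YW]].
have [|X1 MX1 sX1] := below W NW; first by rewrite -YW.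
rewrite properE negb_and negbK -implybE; apply/implyP=> sYX.
rewrite -YW in sX1; have := ucircuits_anti (supp_circuit MX1) (supp_circuit MX).
by move=> /(_ (subset_trans sX1 sYX)) <-.
Qed.

End Lifting.

Section InducedConsistent.
Variable E : finType.
Implicit Types (X Y : signed_set E) (A B : {set E}).

(** Z opposes every extended positive Y' at the new element, so it agrees with Y' at some element of
    A. For Y this gives [e]; for the Y' that meets A in [e] alone, it must be [e] again. *)
Lemma consistent_witness (S : {set signed_set E}) (sg : signed_set E -> sign) A
    (Z : signed_set (option E)) Y :
  (forall e, e \in A ->
    exists Y', [/\ Y' \in S, supp Y' :&: A = [set e] & sg Y' = plus]) ->
  (forall Y', Y' \in S -> sg Y' = plus -> orthogonal Z (extend Y' plus)) ->
  Z None = minus -> (forall e, Z (Some e) != zero -> e \in A) ->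
  Y \in S -> sg Y = plus ->
  exists e Y', [/\ Y' \in S, supp Y' :&: A = [set e], sg Y' = plus & Y' e = Y e].
Proof.
move=> ex orthZ ZN ZA SY sgY.
have agree Y' : Y' \in S -> sg Y' = plus ->
    exists2 e, Z (Some e) != zero & Z (Some e) = Y' e.
  move=> SY' sgY'; have ZN0 : Z None != zero by rewrite ZN.
  have ZNY : Z None = sopp (extend Y' plus None) by rewrite ZN extendE.
  have [[e|] Ze ZY] := orthogonal_agree (orthZ Y' SY' sgY') ZN0 ZNY.
    by exists e; rewrite // ZY extendE.
  by move: ZY; rewrite ZN extendE.
have [e Ze ZY] := agree Y SY sgY; have [Y' [SY' tY' sgY']] := ex e (ZA e Ze).
exists e, Y'; split=> //; have [x Zx ZY'] := agree Y' SY' sgY'.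
have xe : x = e.
  by have /setP/(_ x) := tY'; rewrite !inE -ZY' Zx (ZA x Zx) => /esym/eqP.
by rewrite -ZY -xe ZY'.
Qed.

(** The witness Z is a circuit through the new element inside B plus that element. Otherwise some
    cocircuit through the new element avoids B; it would contain a cocircuit of M, which meets B, or
    be the new element alone, properly inside an extended cocircuit. *)
Lemma extension_consistent (M : oriented_matroid E) N sg :
  generic_cocircuit_signature M sg -> is_extension M N ->
  induced_by_extension M sg N -> consistent (bases M) (cocircuits M) sg.
Proof.
move=> Hsg [_ delN] indN B Y bB MY sgY.
have injS : injective (@Some E) by move=> x y [].
have extN Y' : Y' \in cocircuits M -> sg Y' = plus ->
  extend Y' plus \in cocircuits N.
  move=> MY' sgY'; have := indN _ MY'; rewrite sgY' /extension_signature.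
  by case: pickP => // W /andP[NW /eqP <-] ->; rewrite restrictK.
have UVN := om_dual_pair N.
have [[C UC /andP[NC sC]]|[D VD /andP[ND dD]]] :=
  pair_paint UVN None (Some @: B).
  have [Z [NZ ZC ZN]] := circuit_at false UC NC.
  apply: (@consistent_witness _ _ _ Z) => //.
  - by move=> e eB; apply: basis_cocircuit.
  - by move=> Y' MY' sgY'; apply: om_orthogonal NZ _; apply: extN.
  move=> e; rewrite -suppE ZC => /(subsetP sC).
  by rewrite in_setU in_set1 mem_imset.
have [x xB xD] : exists2 x, x \in B & Some x \in D; last first.
  by move: (disjointFr dD xD); rewrite in_setD1 mem_imset // xB.
have [/existsP[e eD]|/existsPn noD] := boolP [exists e, Some e \in D].
  have [D' VD' /andP[_ sD']] := deletion_cocircuit delN VD eD.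
  have := bB; rewrite bases_pair => /basis_of_pairP[_ /(_ _ VD')[x xD' xB]].
  by exists x; rewrite // (subsetP sD') // imset_f.
have sDY : D \subset supp (extend Y plus).
  by apply/subsetP=> -[e|]; rewrite ?(negPf (noD e)) // suppE extendE.
have DY := pair_antir UVN VD (supp_cocircuit (extN _ MY sgY)) sDY.
have [Y0|[x xY]] := set_0Vmem (supp Y).
  by have := pair_neq0r (om_dual_pair M); rewrite -Y0 supp_cocircuit.
by case/negP: (noD x); rewrite DY suppE extendE -suppE.
Qed.

Lemma contraction_circuit_below (N : oriented_matroid (option E)) W e :
  W \in circuits N -> W (Some e) != zero ->
  exists2 X, X \in contraction_circuits N & supp X \subset supp (restrict W).
Proof.
move=> NW We; pose V := [set restrict X | X in circuits N] :\ signed0 E.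
have VW : restrict W \in V.
  rewrite !inE imset_f // andbT; apply: contraNneq We => /ffunP/(_ e).
  by rewrite restrictE ffunE => ->.
pose p (A : {set E}) := [exists X in V, supp X == A].
have pW : p (supp (restrict W)) by apply/existsP; exists (restrict W);
  rewrite VW eqxx.
have [A /minsetP[/existsP[X /andP[VX /eqP XA]] minA] sA] := minset_exists pW.
exists X; last by rewrite XA.
rewrite inE VX; apply/forall_inP=> Y VY; apply/negP=> /properP[sYX [x xX xY]].
have := minA (supp Y) _; rewrite -XA => YX; move: xY; rewrite YX ?xX //.
by apply/existsP; exists Y; rewrite VY eqxx.
Qed.

(** Here Z is a cocircuit through the new element that avoids B. The alternative, a circuit inside B
    plus that element, would leave a circuit of M inside B or be the new element alone. *)
Lemma lifting_consistent (M : oriented_matroid E) N sg :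
  generic_circuit_signature M sg -> is_lifting M N ->
  induced_by_lifting M sg N -> consistent [set ~: B |
    B in bases M] (circuits M) sg.
Proof.
move=> Hsg [_ conN] indN _ Y /imsetP[B bB ->] MY sgY.
have injS : injective (@Some E) by move=> x y [].
have extN Y' : Y' \in circuits M -> sg Y' = plus ->
  extend Y' plus \in circuits N.
  move=> MY' sgY'; have := indN _ MY'; rewrite sgY' /lifting_signature.
  by case: pickP => // W /andP[NW /eqP <-] ->; rewrite restrictK.
have UVN := om_dual_pair N.
have [[C UC /andP[NC sC]]|[D VD /andP[ND dD]]] :=
  pair_paint UVN None (Some @: B); last first.
  have [Z [NZ ZD ZN]] : exists Z, [/\ Z \in cocircuits N, supp Z = D & Z None = minus].
    rewrite ucocircuitsE in VD.
    exact: (signed_at false (signed_oppr (om_signed_pair N)) VD ND).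
  apply: (@consistent_witness _ _ _ Z) => //.
  - by move=> e; rewrite inE => eB; apply: basis_circuit_signed.
  - by move=> Y' MY' sgY'; rewrite orthogonalC; apply: om_orthogonal NZ;
    apply: extN.
  move=> e; rewrite -suppE ZD => /(disjointFr dD).
  by rewrite in_setD1 mem_imset //= inE => ->.
have [X [MX XC _]] := circuit_at true UC NC.
have /basesP[/indepP iB _] := bB.
have [/existsP[e eC]|/existsPn noC] := boolP [exists e, Some e \in C].
  have [|X' + sX'] := @contraction_circuit_below _ X e MX.
    by rewrite -suppE XC.
  rewrite conN => MX'; case/negP: (iB _ (supp_circuit MX')).
  apply: subset_trans sX' _; apply/subsetP=> x;
    rewrite suppE restrictE -suppE XC.
  by move=> /(subsetP sC); rewrite in_setU in_set1 mem_imset.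
have sCY : C \subset supp (extend Y plus).
  by apply/subsetP=> -[e|]; rewrite ?(negPf (noC e)) // suppE extendE.
have CY := ucircuits_anti UC (supp_circuit (extN _ MY sgY)) sCY.
have [Y0|[x xY]] := set_0Vmem (supp Y).
  by have := ucircuits_neq0 M; rewrite -Y0 supp_circuit.
by case/negP: (noC x); rewrite CY suppE extendE -suppE.
Qed.

End InducedConsistent.

(** * Lexicographic signatures are consistent *)

Section Lexicographic.
Variables (E : finType) (M : oriented_matroid E) (sg : signed_set E -> sign).
Hypothesis Hsg : generic_cocircuit_signature M sg.

(** Otherwise Y opposes the positive fundamental cocircuit D of every [e] of B in its support. Scan
    the list for the first [x] in Y or in one of these D. If [x] is in B, both Y and the D of [x]
    get their sign there, yet they are opposite at [x]. If not, all of them that contain [x] have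
    the sign [b] there. *)
Lemma lexicographic_consistent :
  lexicographic M sg -> consistent (bases M) (cocircuits M) sg.
Proof.
move=> [s0 [_ lexE]] B Y bB MY sgY.
pose near e D := [/\ D \in cocircuits M, supp D :&: B = [set e] & sg D = plus].
have [/existsP[e /andP[eB /eqP YD]]|/existsPn no] :=
    boolP [exists e, (e \in B) && (direction M sg B e == Y e)].
  have [Y' [MY' tY' sgY']] := basis_cocircuit Hsg true bB eB.
  by exists e, Y'; rewrite -(directionE Hsg bB MY' tY' sgY').
exfalso.
have nearB e D : near e D -> e \in B /\ D e != zero.
  by case=> _ /setP/(_ e) + _; rewrite !inE eqxx => /andP[].
have near_only e D x : near e D -> D x != zero -> x \in B -> x = e.
  by move=> [_ /setP/(_ x) + _] Dx xB; rewrite !inE Dx xB => /esym/eqP.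
have nearY e D : near e D -> Y e != zero -> Y e = sopp (D e).
  move=> nD Ye; have [eB De] := nearB e D nD; have [MD tD sgD] := nD.
  apply: sopp_neq => // YD; have := no e;
    rewrite eB (directionE Hsg bB MD tD sgD).
  by rewrite YD eqxx.
suff lex s : lex_sign s Y = plus ->
    (forall e D, Y e != zero -> near e D -> lex_sign s D = plus) -> False.
  apply: (lex s0); first by rewrite -lexE.
  by move=> e D _ [MD _ sgD]; rewrite -lexE.
elim: s => //= -[x b] s IHs.
have [xB|xB] := boolP (x \in B).
  have [D [MD tD sgD]] := basis_cocircuit Hsg true bB xB;
    have nD : near x D by [].
  rewrite !inE; have [Yx|Yx] := eqVneq (Y x) zero.
    move=> lexY lexD; apply: IHs => // e D' Ye nD'; have := lexD e D' Ye nD'.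
    rewrite inE; have [//|D'x] := eqVneq (D' x) zero.
    by move: Ye; rewrite -(near_only e D' x nD' D'x xB) Yx.
  move=> lexY /(_ x D Yx nD); have [_ Dx] := nearB x D nD; rewrite inE Dx.
  move: lexY; rewrite (nearY x D nD Yx).
  by case: (b) (D x) => [] [[]|].
move=> lexY lexD.
pose near_x e D := [&& Y e != zero, D \in cocircuits M, supp D :&: B == [set e],
  sg D == plus & D x != zero].
have [hit|] := boolP ((Y x != zero) || [exists e, exists D, near_x e D]);
  last first.
  rewrite negb_or negbK => /andP[/eqP Yx /existsPn nohit].
  apply: IHs => [|e D Ye nD]; first by move: lexY; rewrite inE Yx eqxx.
  have := lexD e D Ye nD; rewrite inE; have [//|Dx] := eqVneq (D x) zero.
  have [MD tD sgD] := nD; have /existsPn/(_ D) := nohit e.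
  by rewrite /near_x Ye MD tD sgD Dx !eqxx.
have bBp := bB; rewrite bases_pair in bBp.
(* Sign the fundamental circuit of [x] by [b] at [x]. Orthogonality to the D of [p] makes X opposite
   to D at [p], hence equal to Y there. So X and Y agree on their whole common support, which is
   nonempty: a contradiction. *)
have [C UC /andP[xC sC]] := basis_circuit (om_dual_pair M) bBp xB.
have [X [MX XC Xx]] := circuit_at b UC xC.
have XB p : X p != zero -> p = x \/ p \in B.
  by rewrite -suppE XC => /(subsetP sC); rewrite !inE => /orP[/eqP|];
    [left|right].
have smul_plus c t : smul c t = plus -> t = Some c by case: c t => [] [[]|].
have Dx e D : Y e != zero -> near e D -> D x != zero -> D x = Some b.
  by move=> Ye nD Dx; have := lexD e D Ye nD; rewrite inE Dx => /smul_plus.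
have XY p : p \in B -> X p != zero -> Y p != zero -> X p = Y p.
  move=> pB Xp Yp; have [D [MD tD sgD]] := basis_cocircuit Hsg true bB pB.
  have nD : near p D by []; have [_ Dp] := nearB p D nD.
  rewrite (nearY p D nD Yp); apply: sopp_neq => // XD.
  have [q Xq XqD] := orthogonal_disagree (om_orthogonal MX MD) Xp XD.
  have Dq : D q != zero by rewrite -sopp_eq0 -XqD.
  have [qx|qB] := XB q Xq; last first.
    by move: XqD Xq; rewrite (near_only p D q nD Dq qB) XD; case: (D p) =>
      [[]|].
  by move: XqD; rewrite qx Xx (Dx p D Yp nD) -?qx //; case: (b).
have Yx : Y x != zero -> Y x = Some b.
  by move=> Yx; move: lexY; rewrite inE Yx => /smul_plus.
have [q Xq XYq] : exists2 q, X q != zero & X q = Y q.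
  move: hit; have [Yx0|Yx0 _] := eqVneq (Y x) zero; last first.
    by exists x; rewrite Xx // Yx.
  move=> /existsP[e /existsP[D /and5P[Ye MD /eqP tD /eqP sgD Dx0]]].
  have nD : near e D by [].
  have Xx0 : X x != zero by rewrite Xx.
  have [|q Xq XqD] := orthogonal_disagree (om_orthogonal MX MD) Xx0.
    by rewrite Xx (Dx e D Ye nD Dx0).
  have Dq : D q != zero by rewrite -sopp_eq0 -XqD.
  have [qx|qB] := XB q Xq.
    by move: XqD; rewrite qx Xx (Dx e D Ye nD Dx0); case: (b).
  have qe := near_only e D q nD Dq qB.
  by exists q => //; apply: XY; rewrite // qe.
have [p Xp XYp] := orthogonal_disagree (om_orthogonal MX MY) Xq XYq.
have Yp : Y p != zero by rewrite -sopp_eq0 -XYp.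
have [px|pB] := XB p Xp.
  by move: XYp; rewrite px Xx Yx -?px //; case: (b).
by move: XYp; rewrite (XY p pB Xp Yp); case: (Y p) Yp => [[]|].
Qed.

End Lexicographic.

(** * The map beta *)

Section Bijection.
Variables (E : finType) (M : oriented_matroid E).
Variables (sigma sigmas : signed_set E -> sign).
Hypotheses (Hsigma : generic_circuit_signature M sigma)
  (Hsigmas : generic_cocircuit_signature M sigmas).
Implicit Types (B : {set E}) (X Y : signed_set E) (O : orientation E) (K : {set E}).

Lemma positive_signingP (S : {set signed_set E}) (sg : signed_set E ->
  sign) A e :
  signature_on S sg -> generic_on S sg -> (forall X, X \in S ->
    signed_opp X \in S) ->
  A \in [set supp X | X in S] -> e \in A ->
  [/\ positive_signing S sg A \in S, supp (positive_signing S sg A) = A,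
      sg (positive_signing S sg A) = plus &
      positive_signing S sg A e = Some (positive_signing S sg A e == plus)].
Proof.
move=> sgN sg0 oppS /imsetP[X SX AX] eA.
have [X1 [SX1 sX1 sgX1]] : exists X1, [/\ X1 \in S, supp X1 = A & sg X1 = plus].
  case sgX: (sg X) (sg0 _ SX) => [[]|] // _; first by exists X.
  by exists (signed_opp X); rewrite oppS // supp_opp sgN // sgX.
rewrite /positive_signing; case: pickP =>
  /= [X2 /and3P[SX2 /eqP sX2 /eqP sgX2]|/(_ X1)].
  split=> //; move: eA; rewrite -sX2 suppE.
  by case: (X2 e) => [[]|].
by rewrite SX1 sX1 sgX1 !eqxx.
Qed.

Lemma beta_in B e : B \in bases M -> e \in B ->
  exists Y, [/\ Y \in cocircuits M, supp Y :&: B = [set e], sigmas Y = plus &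
    Y e = Some (beta M sigma sigmas B e)].
Proof.
move=> bB eB; have [sgN sg0] := Hsigmas.
have [Y0 [MY0 tY0 _]] := basis_cocircuit Hsigmas true bB eB.
have /basis_of_pairP[_ meetB] : basis_of_pair (ucircuits M) (ucocircuits M) B.
  by rewrite -bases_pair.
rewrite /beta ffunE eB /fund_cocircuit; case: pickP =>
  /= [D /andP[VD dD]|/(_ (supp Y0))].
  have DB x : x \in B -> x \in D -> x = e.
    move=> xB xD; have := disjointFr dD xD; rewrite in_setD1 xB andbT.
    by move/negbFE/eqP.
  have [x xD xB] := meetB _ VD; have eD : e \in D by rewrite -(DB x xB xD).
  have SD := VD; rewrite ucocircuitsE in SD.
  have [SY sY sgY Ye] := positive_signingP sgN sg0 (@cocircuits_opp _ M) SD eD.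
  exists (positive_signing (cocircuits M) sigmas D); split=> //.
  rewrite sY; apply/setP=> y; rewrite in_setI in_set1.
  by apply/andP/eqP=> [[yD yB]|->] //; apply: DB.
rewrite supp_cocircuit //=; case/negP; apply/pred0P=> x /=.
rewrite in_setD1; have /setP/(_ x) := tY0; rewrite in_setI in_set1.
by case: (x \in supp Y0); case: (x \in B); case: (x == e).
Qed.

Lemma beta_notin B e : B \in bases M -> e \notin B ->
  exists X, [/\ X \in circuits M, supp X :&: ~: B = [set e], sigma X = plus &
    X e = Some (beta M sigma sigmas B e)].
Proof.
move=> bB eB; have [sgN sg0] := Hsigma.
have bBp : basis_of_pair (ucircuits M) (ucocircuits M) B by rewrite -bases_pair.
rewrite /beta ffunE (negPf eB) /fund_circuit; case: pickP =>
  /= [C /andP[UC sC]|none].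
  have tC := basis_circuit_trace bBp UC sC eB.
  have eC : e \in C by have /setP/(_ e) := tC; rewrite in_setD in_set1 eqxx =>
    /andP[].
  have [SX sX sgX Xe] := positive_signingP sgN sg0 (@circuits_opp _ M) UC eC.
  exists (positive_signing (circuits M) sigma C); split=> //.
  by rewrite sX -setDE.
have [C UC /andP[_ sC]] := basis_circuit (om_dual_pair M) bBp eB.
by have := none C; rewrite UC sC.
Qed.

Lemma beta_cocircuit_agree B Y : consistent (bases M) (cocircuits M) sigmas ->
  B \in bases M -> Y \in cocircuits M -> sigmas Y = plus ->
  exists2 e, e \in B & Y e = Some (beta M sigma sigmas B e).
Proof.
move=> cons bB MY sgY; have [e [Y' [MY' tY' sgY' Ye]]] := cons B Y bB MY sgY.
have eB : e \in B by have /setP/(_ e) := tY'; rewrite !inE eqxx => /andP[].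
exists e => //; rewrite -Ye; have [Y1 [MY1 tY1 sgY1 <-]] := beta_in bB eB.
by rewrite -(directionE Hsigmas bB MY' tY' sgY') (directionE Hsigmas bB MY1 tY1 sgY1).
Qed.

Lemma beta_circuit_agree B X : consistent [set ~: B |
  B in bases M] (circuits M) sigma ->
  B \in bases M -> X \in circuits M -> sigma X = plus ->
  exists2 e, e \notin B & X e = Some (beta M sigma sigmas B e).
Proof.
move=> cons bB MX sgX.
have [e [X' [MX' tX' sgX' Xe]]] := cons (~: B) X (imset_f _ bB) MX sgX.
have eB : e \notin B by have /setP/(_ e) := tX'; rewrite !inE eqxx => /andP[].
exists e => //; rewrite -Xe; have [X1 [MX1 tX1 sgX1 <-]] := beta_notin bB eB.
have [Md [dM Md']] := om_dual M.
have HsgD : generic_cocircuit_signature Md sigma by rewrite /generic_cocircuit_signature Md'.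
have bBd : ~: B \in bases Md by rewrite (bases_dual _ dM).
rewrite -Md' in MX' MX1.
by rewrite -(directionE HsgD bBd MX' tX' sgX') (directionE HsgD bBd MX1 tX1 sgX1).
Qed.

Lemma conformal_opp_agree O X e : conformal O X ->
  signed_opp X e = Some (O e) -> False.
Proof.
move=> /forall_inP cO; rewrite signed_oppE => Xe.
have eX : e \in supp X by rewrite suppE -sopp_eq0 Xe.
by have := cO e eX; move: Xe; case: (X e) (O e) => [[]|] [].
Qed.

(** If Y is conformal but negative, its opposite is positive and must agree with beta(B)
    somewhere. *)
Lemma beta_cocircuit_compatible B : consistent (bases M) (cocircuits M) sigmas ->
  B \in bases M -> cocircuit_compatible M sigmas (beta M sigma sigmas B).
Proof.
move=> cons bB; apply/forall_inP=> Y MY; apply/implyP=> cY.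
have [sgN sg0] := Hsigmas; case sgY: (sigmas Y) (sg0 _ MY) => [[]|] // _.
have [|e _] := @beta_cocircuit_agree B (signed_opp Y) cons bB (cocircuits_opp MY).
  by rewrite sgN // sgY.
by move/(conformal_opp_agree cY).
Qed.

Lemma beta_circuit_compatible B : consistent [set ~: B |
  B in bases M] (circuits M) sigma ->
  B \in bases M -> circuit_compatible M sigma (beta M sigma sigmas B).
Proof.
move=> cons bB; apply/forall_inP=> X MX; apply/implyP=> cX.
have [sgN sg0] := Hsigma; case sgX: (sigma X) (sg0 _ MX) => [[]|] // _.
have [|e _] := @beta_circuit_agree B (signed_opp X) cons bB (circuits_opp MX).
  by rewrite sgN // sgX.
by move/(conformal_opp_agree cX).
Qed.

Lemma beta_injective : consistent (bases M) (cocircuits M) sigmas ->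
  consistent [set ~: B | B in bases M] (circuits M) sigma ->
  {in bases M &, injective (beta M sigma sigmas)}.
Proof.
move=> consC consL B1 B2 bB1 bB2 eqO; set O := beta M sigma sigmas B1 in eqO.
have [sub|/subsetPn[a aB1 aB2]] := boolP (B1 \subset B2).
  by apply: basis_subset (om_dual_pair M) _ _ _ _ sub; rewrite -bases_pair.
(* Circuits are allowed any sign on both bases, the sign opposite to O on B1 only, that of O on B2
   only, and none elsewhere. A positive circuit would have to agree with O outside B2, a negative
   one to oppose O outside B1; neither is possible, and cocircuits fail likewise. *)
pose P := [set x | if x \in B1 then (x \in B2) ||
  ~~ O x else (x \in B2) && O x].
pose Q := [set x | if x \in B1 then (x \in B2) ||
  O x else (x \in B2) && ~~ O x].
exfalso; have [[X [MX Xa fX]]|[Y [MY Ya fY]]] :=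
    signed_painting (om_signed_pair M) a (~~ O a) P Q.
  have hX x : (X x = plus -> x \in P) /\ (X x = minus -> x \in Q).
    have [->|xa] := eqVneq x a; last exact: fX.
    by rewrite Xa !inE aB1 (negPf aB2) /=; case: (O a).
  have [sgN sg0] := Hsigma; case sgX: (sigma X) (sg0 _ MX) => [[]|] // _.
    have [e eB2 Xe] := beta_circuit_agree consL bB2 MX sgX.
    have := hX e; rewrite Xe -eqO !inE (negPf eB2) /=.
    by case: (e \in B1) (O e) => [] [] /= [h1 h2]; [have := h1 erefl|have :=
      h2 erefl|have := h1 erefl|have := h2 erefl].
  have [|e eB1 Xe] := beta_circuit_agree consL bB1 (circuits_opp MX).
    by rewrite sgN // sgX.
  have Xe' : X e = Some (~~ O e) by rewrite -[X e]soppK -signed_oppE Xe.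
  have := hX e; rewrite Xe' !inE (negPf eB1) /=.
  by case: (e \in B2) (O e) => [] [] /= [h1 h2]; [have := h2 erefl|have :=
    h1 erefl|have := h2 erefl|have := h1 erefl].
have hY x : (Y x = plus -> x \notin Q) /\ (Y x = minus -> x \notin P).
  have [->|xa] := eqVneq x a; last exact: fY.
  by rewrite Ya !inE aB1 (negPf aB2) /=; case: (O a).
have [sgN sg0] := Hsigmas; case sgY: (sigmas Y) (sg0 _ MY) => [[]|] // _.
  have [e eB1 Ye] := beta_cocircuit_agree consC bB1 MY sgY.
  have := hY e; rewrite Ye !inE eB1 -/O /=.
  by case: (e \in B2) (O e) => [] [] /= [h1 h2]; [have := h1 erefl|have :=
    h2 erefl|have := h1 erefl|have := h2 erefl].
have [|e eB2 Ye] := beta_cocircuit_agree consC bB2 (cocircuits_opp MY).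
  by rewrite sgN // sgY.
have Ye' : Y e = Some (~~ O e) by rewrite -[Y e]soppK -signed_oppE Ye -eqO.
have := hY e; rewrite Ye' !inE eB2 /=.
by case: (e \in B1) (O e) => [] [] /= [h1 h2]; [have := h2 erefl|have :=
  h1 erefl|have := h2 erefl|have := h1 erefl].
Qed.

(* On K the value of O no longer is an orientation: true (resp. false) marks an
   element as contracted (resp. deleted). *)
Definition minor_conformal (m : bool) K O X :=
  [forall x in supp X, if x \in K then O x == m else X x == Some (O x)].

Definition minor_compatible K O :=
  [forall X in circuits M, minor_conformal true K O X ==> (sigma X == plus)] &&
  [forall Y in cocircuits M, minor_conformal false K O Y ==>
    (sigmas Y == plus)].

Definition flip (e : E) O : orientation E := [ffun x => (x == e) (+) O x].

Lemma flipK e : involutive (flip e).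
Proof. by move=> O; apply/ffunP=> x; rewrite !ffunE addbA addbb. Qed.

Lemma minor_conformalU m K O O' X e : e \notin K ->
  (forall x, x != e -> O' x = O x) ->
  X e = zero \/ O' e = m /\ X e = Some (O e) ->
  minor_conformal m (e |: K) O' X -> minor_conformal m K O X.
Proof.
move=> eK OO' Xe /forall_inP cX; apply/forall_inP=> x xX.
have [xe|xe] := eqVneq x e.
  by case: Xe xX => [Xe|[_ Xe] _]; rewrite xe ?suppE ?Xe // (negPf eK) eqxx.
by have := cX x xX; rewrite in_setU1 (negPf xe) /= OO'.
Qed.

Lemma minor_conformal_at m K O X e : minor_conformal m (e |: K) O X ->
  X e = zero \/ O e = m.
Proof.
move=> /forall_inP cX; have [Xe|Xe] := eqVneq (X e) zero; [by left|right].
by have := cX e; rewrite suppE in_setU1 eqxx => /(_ Xe)/eqP.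
Qed.

Lemma minor_compatibleN K O : ~~ minor_compatible K O ->
  (exists X, [/\ X \in circuits M, minor_conformal true K O X & sigma X != plus]) \/
  (exists Y, [/\ Y \in cocircuits M, minor_conformal false K O Y & sigmas Y != plus]).
Proof.
rewrite negb_and => /orP[]/forall_inPn[X MX]; rewrite negb_imply => /andP[? ?].
  by left; exists X.
by right; exists X.
Qed.

Lemma minor_compatible_circuit K O X : minor_compatible K O ->
  X \in circuits M ->
  minor_conformal true K O X -> sigma X = plus.
Proof. by move=> /andP[/forall_inP h _] MX cX; apply/eqP/(implyP (h X MX)). Qed.

Lemma minor_compatible_cocircuit K O Y : minor_compatible K O ->
  Y \in cocircuits M ->
  minor_conformal false K O Y -> sigmas Y = plus.
Proof. by move=> /andP[_ /forall_inP h] MY cY; apply/eqP/(implyP (h Y MY)). Qed.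

(** A violation that vanishes at [e] or agrees with O there is one before the step. So if
    contraction and deletion both fail, they fail by a circuit X and a cocircuit Y that both oppose
    O at [e]. Agreeing there, they must disagree elsewhere; but outside K both follow O, and inside
    K the one has only contracted, the other only deleted elements. *)
Lemma minor_step K O O1 O0 e : e \notin K ->
  (forall x, x != e -> O1 x = O x) -> (forall x, x != e -> O0 x = O x) ->
  O1 e = true -> O0 e = false -> minor_compatible K O ->
  minor_compatible (e |: K) O1 || minor_compatible (e |: K) O0.
Proof.
move=> eK O1E O0E O1e O0e comp; apply: contraT; rewrite negb_or => /andP[n1 n0].
have [X [MX cX sgX Xe]] : exists X, [/\ X \in circuits M,
    minor_conformal true (e |: K) O1 X, sigma X != plus & X e = Some (~~ O e)].
  have [[X [MX cX sgX]]|[Y [MY cY sgY]]] := minor_compatibleN n1.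
    exists X; split=> //; case Xe: (X e) => [b|].
      apply: contraNeq sgX => XO; apply/eqP/(minor_compatible_circuit comp MX).
      apply: minor_conformalU cX => //; right; split=> //.
      by rewrite Xe; move: XO; rewrite /=; case: b (O e) Xe => [] [].
    case/eqP: sgX; apply: (minor_compatible_circuit comp MX).
    by apply: minor_conformalU cX => //; left.
  case/eqP: sgY; apply: (minor_compatible_cocircuit comp MY).
  apply: (minor_conformalU eK O1E _ cY); left.
  by case: (minor_conformal_at cY); rewrite ?O1e.
have [Y [MY cY sgY Ye]] : exists Y, [/\ Y \in cocircuits M,
    minor_conformal false (e |: K) O0 Y, sigmas Y != plus & Y e = Some (~~ O e)].
  have [[X' [MX' cX' sgX']]|[Y [MY cY sgY]]] := minor_compatibleN n0;
    last first.
    exists Y; split=> //; case Ye: (Y e) => [b|].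
      apply: contraNeq sgY => YO;
        apply/eqP/(minor_compatible_cocircuit comp MY).
      apply: minor_conformalU cY => //; right; split=> //.
      by rewrite Ye; move: YO; rewrite /=; case: b (O e) Ye => [] [].
    case/eqP: sgY; apply: (minor_compatible_cocircuit comp MY).
    by apply: minor_conformalU cY => //; left.
  case/eqP: sgX'; apply: (minor_compatible_circuit comp MX').
  apply: (minor_conformalU eK O0E _ cX'); left.
  by case: (minor_conformal_at cX'); rewrite ?O0e.
have Xe0 : X e != zero by rewrite Xe.
have XYe : X e = Y e by rewrite Xe Ye.
have [x Xx XY] := orthogonal_disagree (om_orthogonal MX MY) Xe0 XYe.
have Yx : Y x != zero by rewrite -sopp_eq0 -XY.
have [xe|xe] := eqVneq x e; first by move: XY; rewrite xe XYe Ye; case: (O e).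
have := forall_inP cX x; have := forall_inP cY x; rewrite !suppE =>
  /(_ Yx) + /(_ Xx).
rewrite in_setU1 (negPf xe) /= O1E // O0E //.
case: (x \in K); first by move=> /eqP ->.
by move=> /eqP Yx' /eqP Xx'; move: XY; rewrite Yx' Xx'; case: (O x).
Qed.

(** A violating set is conformal, before the step, with the orientation that has its sign at [e]. *)
Lemma minor_step2 K O O' e : e \notin K -> (forall x, x != e -> O' x = O x) ->
  minor_compatible K O -> minor_compatible K (flip e O) ->
  minor_compatible (e |: K) O'.
Proof.
move=> eK O'E comp comp'; apply: contraT => /minor_compatibleN n.
have fE x : x != e -> O' x = flip e O x.
  by move=> xe; rewrite ffunE (negPf xe) O'E.
have pick m X : minor_conformal m (e |: K) O' X ->
    minor_conformal m K O X \/ minor_conformal m K (flip e O) X.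
  move=> cX; case Xe: (X e) (minor_conformal_at cX) => [b|] mX.
    have O'e : O' e = m by case: mX.
    have [bO|bO] := eqVneq b (O e).
      by left; apply: minor_conformalU cX => //; right; rewrite Xe bO.
    right; apply: minor_conformalU cX => //; right; rewrite Xe ffunE eqxx;
      split=> //.
    by move: bO; case: (b) (O e) => [] [].
  by left; apply: minor_conformalU cX => //; left.
case: n => -[X [MX cX /eqP[]]].
  by case: (pick _ _ cX); apply: minor_compatible_circuit.
by case: (pick _ _ cX); apply: minor_compatible_cocircuit.
Qed.

Definition minor_count K := #|[set O | minor_compatible K O]|.

Lemma minor_count_step K e : e \notin K ->
  minor_count K <= minor_count (e |: K).
Proof.
move=> eK; rewrite -leq_double -!addnn /minor_count -!sum1_card.
have flip_sum (p : pred (orientation E)) :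
    \sum_(O in [set O | p O]) 1 + \sum_(O in [set O | p O]) 1 =
    \sum_O (p O + p (flip e O)).
  rewrite big_split /=; have cnt : \sum_(O in [set O | p O]) 1 = \sum_O p O.
    by rewrite big_mkcond; apply: eq_bigr => O _; rewrite inE; case: (p O).
  rewrite cnt; congr (_ + _); rewrite (reindex_inj (can_inj (flipK e))).
  by apply: eq_bigr.
rewrite !flip_sum; apply: leq_sum => O _.
have flipE x : x != e -> flip e O x = O x by move=> xe;
  rewrite ffunE (negPf xe).
have flipe : flip e O e = ~~ O e by rewrite ffunE eqxx.
have step O1 : O1 = O \/ O1 = flip e O -> minor_compatible K O1 ->
    minor_compatible (e |: K) O || minor_compatible (e |: K) (flip e O).
  move=> O1E comp; have O1e x : x != e -> O x = O1 x.
    by move=> xe; case: O1E => ->; rewrite ?flipE.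
  have O1e' x : x != e -> flip e O x = O1 x.
    by move=> xe; rewrite flipE // O1e.
  case Oe: (O e) flipe => /= flipe; first exact: minor_step comp.
  by rewrite orbC; apply: minor_step comp.
have [c1|c1] := boolP (minor_compatible K O); have [c2|c2] :=
  boolP (minor_compatible K (flip e O)).
- by rewrite !(@minor_step2 K O _ e).
- by have := step O (or_introl erefl) c1; do 2 case: minor_compatible.
- by have := step _ (or_intror erefl) c2; do 2 case: minor_compatible.
by [].
Qed.

Lemma minor_count0 : minor_count set0 = #|[set O |
  compatible M sigma sigmas O]|.
Proof.
have conf m O X : minor_conformal m set0 O X = conformal O X.
  apply: eq_forallb => x; congr (_ ==> _); rewrite inE; apply: eq_sym.
rewrite /minor_count; congr #|pred_of_set _|; apply/setP=> O; rewrite !inE.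
by congr (_ && _); apply: eq_forallb => X; rewrite conf.
Qed.

(** The contracted elements form a basis: signs no longer matter, so a circuit among them would be
    conformal together with its opposite, and sigma cannot be + on both. The same holds for a
    cocircuit among the deleted elements. *)
Lemma minor_countT : minor_count setT <= #|bases M|.
Proof.
pose f (O : orientation E) := [set x | O x].
have f_inj : injective f.
  move=> O O' /setP eqf; apply/ffunP=> x; have := eqf x; rewrite !inE.
  by case: (O x) (O' x) => [] [].
rewrite /minor_count -(card_imset _ f_inj); apply: subset_leq_card.
apply/subsetP=> _ /imsetP[O + ->]; rewrite inE bases_pair => comp.
have conf m X : (forall x, x \in supp X -> O x = m) ->
  minor_conformal m setT O X.
  by move=> h; apply/forall_inP=> x xX; rewrite inE h.
apply/basis_of_pairP; split=> [_ /mem_ucircuits[X MX <-]|D VD].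
  apply/negP=> /subsetP sX; have hX x : x \in supp X -> O x = true.
    by move/sX; rewrite inE.
  have sgX := minor_compatible_circuit comp MX (conf _ _ hX).
  have hX' x : x \in supp (signed_opp X) -> O x = true by rewrite supp_opp;
    apply: hX.
  have [sgN _] := Hsigma.
  have := minor_compatible_circuit comp (circuits_opp MX) (conf _ _ hX').
  by rewrite sgN // sgX.
apply/exists_inP; apply: contraT => /exists_inPn nD.
have [Y [MY sY sgY]] := cocircuit_signed Hsigmas false VD.
have hY x : x \in supp Y -> O x = false by rewrite sY => /nD; rewrite inE =>
  /negPf.
by have := minor_compatible_cocircuit comp MY (conf _ _ hY); rewrite sgY.
Qed.

Lemma card_compatible : #|[set O | compatible M sigma sigmas O]| <= #|bases M|.
Proof.
rewrite -minor_count0; apply: leq_trans minor_countT.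
suff mono n K : #|~: K| <= n ->
  minor_count K <= minor_count setT by exact: (mono _ _ (leqnn _)).
elim: n K => [|n IHn] K.
  by rewrite leqn0 cards_eq0 => /eqP KC; rewrite -(setCK K) KC setC0.
have [KC _|[e eK] ltn] := set_0Vmem (~: K);
  first by rewrite -(setCK K) KC setC0.
rewrite inE in eK; apply: leq_trans (minor_count_step eK) _; apply: IHn.
rewrite -ltnS; apply: leq_trans ltn; apply: proper_card;
  rewrite setCU setIC -setDE.
by apply: properD1; rewrite inE.
Qed.

Lemma beta_bijection : consistent (bases M) (cocircuits M) sigmas ->
  consistent [set ~: B | B in bases M] (circuits M) sigma ->
  {in bases M &, injective (beta M sigma sigmas)} /\
  [set beta M sigma sigmas B | B in bases M] = [set O |
    compatible M sigma sigmas O].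
Proof.
move=> consC consL; have inj := beta_injective consC consL; split=> //.
apply/eqP; rewrite eqEcard card_in_imset // card_compatible andbT.
apply/subsetP=> _ /imsetP[B bB ->]; rewrite inE /compatible.
by rewrite beta_circuit_compatible // beta_cocircuit_compatible.
Qed.

End Bijection.

(** If a positive X agrees with beta(B) nowhere outside B, its opposite is conformal there. A
    lexicographic signature along B makes it conformal on B too, although sigma is - on it. *)
Lemma lexicographic_compatible_consistent (E : finType) (M : oriented_matroid E)
    (sigma : signed_set E -> sign) :
  generic_circuit_signature M sigma ->
  (forall sigmas, generic_cocircuit_signature M sigmas ->
    lexicographic M sigmas ->
    forall B, B \in bases M ->
      circuit_compatible M sigma (beta M sigma sigmas B)) ->
  consistent [set ~: B | B in bases M] (circuits M) sigma.
Proof.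
move=> Hsigma comp _ X /imsetP[B bB ->] MX sgX.
(* A fundamental cocircuit meets B once, so its sign is read at that element whatever the order. The
   chosen signs make beta(B) opposite to X on the support of X in B. *)
pose s := [seq (e, X e == minus) | e <- enum B].
have lexD Y t : lex_sign t (signed_opp Y) = sopp (lex_sign t Y).
  elim: t => //= -[e b] t IHt; rewrite supp_opp IHt; case: ifP => // _.
  by rewrite signed_oppE; case: b.
have lex_at Y e : e \in B -> supp Y :&: B = [set e] ->
  lex_sign s Y = smul (X e == minus) (Y e).
  move=> eB /setP tY; rewrite /s; have : e \in enum B by rewrite mem_enum.
  have : all (mem B) (enum B) by apply/allP=> x; rewrite mem_enum.
  elim: (enum B) => //= x r IHr /andP[xB rB]; rewrite in_cons.
  have := tY x; rewrite in_setI in_set1 xB andbT => ->.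
  by rewrite eq_sym; case: eqP => [->|_] //= er; apply: IHr.
have lex_meet Y e : e \in B -> e \in supp Y -> lex_sign s Y <> zero.
  rewrite -mem_enum /s => + eY; elim: (enum B) => //= x r IHr; rewrite in_cons.
  case: ifP => [xY _|xY /predU1P[ex|/IHr //]]; last by rewrite -ex eY in xY.
  by move: xY; rewrite suppE; case: (Y x) (X x == minus) => [[]|] [].
have /basis_of_pairP[_ meetB] : basis_of_pair (ucircuits M) (ucocircuits M) B.
  by rewrite -bases_pair.
have Hlex : generic_cocircuit_signature M (lex_sign s).
  split=> [Y _|Y MY]; first exact: lexD.
  by have [e eY eB] := meetB _ (supp_cocircuit MY); apply: lex_meet eB eY.
have lexs : lexicographic M (lex_sign s).
  exists s; split=> //; rewrite /unzip1 -map_comp map_id_in ?enum_uniq //.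
have [/existsP[e /andP[eB /eqP Xe]]|/existsPn no] :=
    boolP [exists e, (e \notin B) && (X e == Some (beta M sigma (lex_sign s) B e))].
  have [X' [MX' tX' sgX' X'e]] := beta_notin (lex_sign s) Hsigma bB eB.
  by exists e, X'; rewrite X'e.
have [sgN _] := Hsigma.
have := forall_inP (comp _ Hlex lexs B bB) _ (circuits_opp MX);
  rewrite sgN // sgX.
rewrite implybF => /negP[]; apply/forall_inP=> e;
  rewrite suppE signed_oppE sopp_eq0 => Xe.
apply/eqP; have [eB|eB] := boolP (e \in B).
  have [Y [MY tY lexY Ye]] := beta_in sigma Hlex bB eB.
  rewrite -Ye; move: lexY; rewrite (lex_at Y e eB tY).
  by case: (X e) (Y e) Xe => [[]|] [[]|].
have := no e; rewrite eB /=; move: Xe.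
by case: (X e) (beta _ _ _ _ _) => [[]|] [].
Qed.

Theorem theorem2 (E : finType) (M : oriented_matroid E)
    (sigma : {ffun E -> option bool} -> option bool)
    (Hsigma : generic_circuit_signature M sigma) :
  let lifting_induced :=
    exists M' : oriented_matroid (option E),
      is_lifting M M' /\ induced_by_lifting M sigma M' in
  let extensions_bijective :=
    forall sigmas : {ffun E -> option bool} -> option bool,
      generic_cocircuit_signature M sigmas ->
      (exists M' : oriented_matroid (option E),
        is_generic_extension M M' /\ induced_by_extension M sigmas M') ->
      {in bases M &, injective (beta M sigma sigmas)} /\
      [set beta M sigma sigmas B | B in bases M] =
        [set O | compatible M sigma sigmas O] in
  let lexicographic_compatible :=
    forall sigmas : {ffun E -> option bool} -> option bool,
      generic_cocircuit_signature M sigmas ->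
      lexicographic M sigmas ->
      forall B : {set E}, B \in bases M ->
        circuit_compatible M sigma (beta M sigma sigmas B) in
  (lifting_induced <-> extensions_bijective) /\
  (extensions_bijective <-> lexicographic_compatible).
Proof.
move=> P1 P2 P3.
have P12 : P1 -> P2.
  move=> [N [liftN indN]] sigmas Hsigmas [N' [[extN' _] indN']].
  apply: beta_bijection => //;
    first exact: extension_consistent Hsigmas extN' indN'.
  exact: lifting_consistent Hsigma liftN indN.
have P23 : P2 -> P3.
  move=> bij sigmas Hsigmas lex B bB.
  have cons := lexicographic_consistent Hsigmas lex.
  have [_ /setP/(_ (beta M sigma sigmas B))] :=
    bij _ Hsigmas (extension_exists Hsigmas cons).
  by rewrite imset_f // inE => /esym/andP[].
have P31 : P3 -> P1.
  by move=> comp; apply: lifting_exists Hsigma (lexicographic_compatible_consistent Hsigma comp).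
split; split=> //; first by move=> /P23/P31.
by move=> /P31/P12.
Qed.
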